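(* For every integer $n\ge 0$, $$p_{-1/2}(289n+283)\equiv 0\pmod{289}.$$
   Context: For a rational number $k$, the rational numbers $p_k(n)$ ($n\ge 0$) are the coefficients of the power series $\sum_{n=0}^{\infty}p_{k}(n)q^n=(q;q)_{\infty}^{k}$, where $(q;q)_\infty=\prod_{m=1}^{\infty}(1-q^m)$ and the power is defined by $(q;q)_\infty^{k}=\prod_{m=1}^\infty(1-q^m)^{k}$, each factor being expanded by the generalized binomial theorem $(1-x)^k=\sum_{i\ge 0}\binom{k}{i}(-1)^i x^i$. A rational number $x$ whose reduced denominator is coprime to a positive integer $M$ satisfies $x\equiv 0\pmod M$ if $M$ divides the numerator of $x$ in reduced form. (When $k$ has reduced denominator $b$, every prime dividing the denominator of $p_k(n)$ divides $b$, so the congruence is meaningful.) *)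

(* Defs.v *)
From mathcomp Require Import all_boot all_order all_algebra.

Set Implicit Arguments.
Unset Strict Implicit.
Unset Printing Implicit Defensive.

Import Order.TTheory GRing.Theory Num.Theory.
Local Open Scope ring_scope.

(* A formal power series over the rationals is its sequence of coefficients. *)
Definition fps := nat -> rat.

Definition fps_one : fps := fun n => (n == 0%N)%:R.

Definition fps_mul (f g : fps) : fps :=
  fun n => \sum_(i < n.+1) f i * g (n - i)%N.

Definition gbinom (k : rat) (i : nat) : rat :=
  (\prod_(j < i) (k - j%:R)) / (i`!)%:R.

(* (1 - q^m)^k = sum_i binom(k, i) (-1)^i q^(m i); used only for m > 0. *)
Definition factor_pow (k : rat) (m : nat) : fps :=
  fun n => if (m %| n)%N then gbinom k (n %/ m)%N * (-1) ^+ (n %/ m)%N else 0.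

(* prod_(1 <= m <= N) (1 - q^m)^k *)
Fixpoint euler_partial (k : rat) (N : nat) : fps :=
  if N is N'.+1 then fps_mul (euler_partial k N') (factor_pow k N'.+1)
  else fps_one.

(* The coefficient of q^n in the infinite product: by [euler_partial_stable]
   below, the coefficient of q^n in the partial products is constant from
   N = n on. *)
Definition p_ (k : rat) (n : nat) : rat := euler_partial k n n.

Lemma factor_pow0 (k : rat) (m : nat) : factor_pow k m 0 = 1.
Proof.
by rewrite /factor_pow dvdn0 div0n /gbinom big_ord0 fact0 expr0 mulr1 divr1.
Qed.

Lemma euler_partial_stable (k : rat) (n N : nat) :
  (n <= N)%N -> euler_partial k N n = p_ k n.
Proof.
elim: N => [|N IHN]; first by rewrite leqn0 => /eqP ->.
rewrite leq_eqVlt => /predU1P[-> //|]; rewrite ltnS => le_nN.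
rewrite -(IHN le_nN) /= /fps_mul big_ord_recr /= subnn factor_pow0 mulr1.
rewrite big1 ?add0r // => i _; rewrite /factor_pow gtnNdvd ?mulr0 //.
  by rewrite subn_gt0.
by rewrite ltnS (leq_trans (leq_subr _ _)).
Qed.

(* x = 0 mod M for a rational x; [numq] and [denq] are the numerator and the
   positive denominator of the reduced form. *)
Definition rat_cong0 (x : rat) (M : nat) : Prop :=
  coprimez (denq x) M%:Z /\ (M%:Z %| numq x)%Z.

(* Main.v *)
(* Let theta = q d/dq, let P, Q, R be the Eisenstein series of weights 2, 4, 6,
   let Delta = (Q^3 - R^2) / 1728, and work in (Z/289)[[q]].  The logarithmic
   derivative of phi = q^6 sum p_(-1/2)(n) q^n is -(P - 1)/48 + 6 = 6 P, as
   -1/48 = 6 mod 289, and it is also that of Delta^6.  So phi = Delta^6 w with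
   theta w = 0, and it suffices that the coefficients of Delta^6 are 0 mod 17 at
   multiples of 17 and 0 mod 289 at multiples of 289.

   By Ramanujan's differential equations theta acts on polynomials in P, Q, R.
   Let A have weight 16 and A = 1 mod 17.  Weights 16 and 84 are such that
   theta^2 A = 17 N and Delta^6 A = theta^2 (Delta^6 f) + 17 Delta^6 T for explicit
   polynomials f, N, T.  Since A - 1 = 17 K and (theta^2 u) K = u theta^2 K modulo
   the image of theta, the coefficient of Delta^6 at a multiple of 17 is 17 times
   that of F = Delta^6 (T - f N).  Modulo 17, F = theta^16 F + u^17 with
   u = Delta (6 Q^3 + 7 R^2), so it is the coefficient of u(q^17), and
   u = theta^16 u kills the coefficients of u at the multiples of 17. *)

Require Import Defs.
From Stdlib Require Import NArith.
From HB Require Import structures.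
From mathcomp Require Import all_boot all_order all_algebra.
From mathcomp Require Import boolp ring zify.

Set Implicit Arguments.
Unset Strict Implicit.
Unset Printing Implicit Defensive.

Import GRing.Theory.
Local Open Scope ring_scope.

(** * Formal power series *)

Record pser (R : Type) := PSer { coef : nat -> R }.

HB.instance Definition _ (R : Type) := gen_eqMixin (pser R).
HB.instance Definition _ (R : Type) := gen_choiceMixin (pser R).

Lemma pserP (R : Type) (f g : pser R) : (forall n, coef f n = coef g n) -> f = g.
Proof. by case: f g => [f] [g] /= fg; congr PSer; apply: functional_extensionality_dep. Qed.

Section PowerSeriesRing.
Variable R : comNzRingType.
Implicit Types f g h : pser R.

Definition pser_add f g := PSer (fun n => coef f n + coef g n).
Definition pser_opp f := PSer (fun n => - coef f n).
(** Locked so that simplification does not unfold products; [pser_mulE] gives access to the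
    coefficients. *)
Definition pser_mul := locked (fun f g =>
  PSer (fun n => \sum_(i < n.+1) coef f i * coef g (n - i))).
Definition pser_const (c : R) := PSer (fun n => if n == 0%N then c else 0).

Fact pser_mulE f g n :
  coef (pser_mul f g) n = \sum_(i < n.+1) coef f i * coef g (n - i).
Proof. by rewrite /pser_mul -lock. Qed.

Fact pser_addA : associative pser_add.
Proof. by move=> f g h; apply: pserP => n /=; rewrite addrA. Qed.
Fact pser_addC : commutative pser_add.
Proof. by move=> f g; apply: pserP => n /=; rewrite addrC. Qed.
Fact pser_add0 : left_id (pser_const 0) pser_add.
Proof. by move=> f; apply: pserP => n /=; rewrite if_same add0r. Qed.
Fact pser_addN : left_inverse (pser_const 0) pser_opp pser_add.
Proof. by move=> f; apply: pserP => n /=; rewrite addNr if_same. Qed.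

HB.instance Definition _ := GRing.isZmodule.Build (pser R)
  pser_addA pser_addC pser_add0 pser_addN.

Definition trunc N f : {poly R} := \poly_(i < N.+1) coef f i.

(** A coefficient of a product involves only finitely many coefficients of the factors, so
    associativity and commutativity are inherited from [{poly R}]. *)
Lemma coef_trunc_mul N f g n : (n <= N)%N ->
  (trunc N f * trunc N g)`_n = coef (pser_mul f g) n.
Proof.
move=> le_nN; rewrite coefM pser_mulE; apply: eq_bigr => i _; rewrite !coef_poly.
by rewrite !ltnS !(leq_trans _ le_nN) ?leq_subr // -ltnS.
Qed.

Fact pser_mulA : associative pser_mul.
Proof.
move=> f g h; apply: pserP => n.
have -> : coef (pser_mul f (pser_mul g h)) n
    = (trunc n f * (trunc n g * trunc n h))`_n.
  rewrite coefM pser_mulE; apply: eq_bigr => i _.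
  by rewrite coef_trunc_mul ?leq_subr // coef_poly ltn_ord.
rewrite mulrA coefM pser_mulE; apply: eq_bigr => i _.
by rewrite coef_trunc_mul -1?ltnS // coef_poly ltnS leq_subr.
Qed.

Fact pser_mulC : commutative pser_mul.
Proof.
by move=> f g; apply: pserP => n; rewrite -!(coef_trunc_mul _ _ (leqnn n)) mulrC.
Qed.

Fact pser_mul1 : left_id (pser_const 1) pser_mul.
Proof.
move=> f; apply: pserP => n; rewrite pser_mulE.
by rewrite big_ord_recl /= mul1r subn0 big1 ?addr0 // => i _; rewrite mul0r.
Qed.

Fact pser_mulD : left_distributive pser_mul pser_add.
Proof.
move=> f g h; apply: pserP => n; rewrite /= !pser_mulE -big_split; apply: eq_bigr => i _.
by rewrite mulrDl.
Qed.

Fact pser_1_neq0 : pser_const 1 != 0.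
Proof.
by apply/eqP => /(congr1 (fun f => coef f 0)) /= /eqP; rewrite oner_eq0.
Qed.

HB.instance Definition _ := GRing.Zmodule_isComNzRing.Build (pser R)
  pser_mulA pser_mulC pser_mul1 pser_mulD pser_1_neq0.

Lemma pser_coefD f g n : coef (f + g) n = coef f n + coef g n. Proof. by []. Qed.
Lemma pser_coefB f g n : coef (f - g) n = coef f n - coef g n. Proof. by []. Qed.
Lemma pser_coef0 n : coef (0 : pser R) n = 0. Proof. by rewrite /= if_same. Qed.
Lemma pser_coef1 n : coef (1 : pser R) n = (n == 0%N)%:R. Proof. by rewrite /=; case: eqP. Qed.
Lemma pser_coefM f g n : coef (f * g) n = \sum_(i < n.+1) coef f i * coef g (n - i).
Proof. exact: pser_mulE. Qed.

Lemma coef_natmul f k n : coef (f *+ k) n = coef f n *+ k.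
Proof. by elim: k => [|k IHk]; rewrite ?mulr0n ?pser_coef0 // !mulrS pser_coefD IHk. Qed.

Lemma coef_natl f k n : coef (k%:R * f) n = k%:R * coef f n.
Proof. by rewrite !mulr_natl coef_natmul. Qed.

Lemma pser_coefM0 f g : coef (f * g) 0 = coef f 0 * coef g 0.
Proof. by rewrite pser_coefM big_ord_recl big_ord0 addr0. Qed.

Lemma pser_coefX0 f k : coef (f ^+ k) 0 = coef f 0 ^+ k.
Proof. by elim: k => [|k IHk]; rewrite ?pser_coef1 // !exprS pser_coefM0 IHk. Qed.

Definition qX : pser R := PSer (fun n => (n == 1%N)%:R).

Lemma coef_qXM f n : coef (qX * f) n = if n is n'.+1 then coef f n' else 0.
Proof.
rewrite pser_coefM; case: n => [|n]; first by rewrite big_ord_recl big_ord0 mul0r addr0.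
rewrite big_ord_recl mul0r add0r big_ord_recl /= mul1r subSS subn0 big1 ?addr0 //.
by move=> i _; rewrite mul0r.
Qed.

Lemma coef_qXnM f k n : coef (qX ^+ k * f) n = if (n < k)%N then 0 else coef f (n - k).
Proof.
elim: k n => [|k IHk] n; first by rewrite expr0 mul1r subn0.
rewrite exprS -mulrA coef_qXM; case: n => [|n]; first by rewrite ltn0Sn.
by rewrite IHk ltnS subSS.
Qed.

Lemma qXM_inj f g : qX * f = qX * g -> f = g.
Proof.
by move=> fg; apply: pserP => n; have := congr1 (fun f => coef f n.+1) fg;
  rewrite !coef_qXM.
Qed.

Definition shift f := PSer (fun n => coef f n.+1).

Lemma shiftK f : f = pser_const (coef f 0) + qX * shift f.
Proof.
by apply: pserP => -[|n]; rewrite pser_coefD coef_qXM /= ?addr0 ?add0r.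
Qed.

Definition theta f := PSer (fun n => n%:R * coef f n).

Lemma theta_is_zmod_morphism : zmod_morphism theta.
Proof. by move=> f g; apply: pserP => n /=; rewrite mulrBr. Qed.

HB.instance Definition _ := GRing.isZmodMorphism.Build (pser R) (pser R) theta
  theta_is_zmod_morphism.

Lemma thetaM f g : theta (f * g) = theta f * g + f * theta g.
Proof.
apply: pserP => n; rewrite pser_coefD /= !pser_coefM -big_split mulr_sumr.
apply: eq_bigr => i _ /=.
rewrite -{1}(subnKC (_ : i <= n)%N) -1?ltnS // natrD; ring.
Qed.

Lemma theta1 : theta 1 = 0.
Proof. by apply: pserP => -[|n] /=; rewrite ?mul0r ?mulr0. Qed.

Lemma thetaX f k : theta (f ^+ k) = k%:R * f ^+ k.-1 * theta f.
Proof.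
elim: k => [|k IHk]; first by rewrite theta1 !mul0r.
rewrite exprS thetaM IHk /=; case: k {IHk} => [|k] /=; first by ring.
by rewrite exprS; ring.
Qed.

Lemma theta_natl k f : theta (k%:R * f) = k%:R * theta f.
Proof. by rewrite !mulr_natl raddfMn. Qed.

Lemma theta_qX : theta qX = qX.
Proof. by apply: pserP => -[|[|n]] /=; rewrite ?mulr0 ?mulr1. Qed.

Lemma coef_theta f n : coef (theta f) n = n%:R * coef f n. Proof. by []. Qed.

Lemma coef_iter_theta k f n : coef (iter k theta f) n = n%:R ^+ k * coef f n.
Proof. by elim: k => [|k IHk]; rewrite ?mul1r // iterS coef_theta IHk exprS mulrA. Qed.

End PowerSeriesRing.

(** * Convolutions of divisor sums and Ramanujan's differential equations *)

(** The sum is empty at n = 0, so series of divisor sums have constant term 0. *)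
Definition divisor_sum (G : nat -> int) (n : nat) : int :=
  \sum_(d < n.+1 | (0 < d)%N && (d %| n)%N) G d.

Definition sigma (j : nat) : nat -> int := divisor_sum (fun d => d%:R ^+ j).

Lemma big_bij (V : zmodType) (I J : finType) (P : pred I) (Q : pred J)
    (h : I -> J) (h' : J -> I) (F : I -> V) (G : J -> V) :
  (forall i, P i -> Q (h i) /\ h' (h i) = i) ->
  (forall j, Q j -> P (h' j) /\ h (h' j) = j) ->
  (forall i, P i -> F i = G (h i)) ->
  \sum_(i | P i) F i = \sum_(j | Q j) G j.
Proof.
move=> hP h'Q FG; rewrite [RHS](reindex_onto h h') => [|j Qj]; last first.
  by case: (h'Q j Qj).
apply: eq_big => [i|//]; apply/idP/andP => [/hP[-> ->]//|[Qhi /eqP ihi]].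
by rewrite -ihi; case: (h'Q _ Qhi).
Qed.

(** * Sums over the positive solutions of a x + b y = N *)

Section Quadruples.
Variable N : nat.

Notation I := 'I_N.+1.
Notation quad := (I * I * I * I)%type.

(* The quadruples (a, b, x, y) of positive integers with a x + b y = N. *)
Definition quad_ok (t : quad) : bool :=
  let: (a, b, x, y) := t in
  [&& (0 < a)%N, (0 < b)%N, (0 < x)%N, (0 < y)%N & (a * x + b * y == N)%N].

Definition qa (t : quad) : nat := t.1.1.1.
Definition qb (t : quad) : nat := t.1.1.2.
Definition qx (t : quad) : nat := t.1.2.
Definition qy (t : quad) : nat := t.2.

Implicit Types F G h : nat -> nat -> int.

Definition quad_sum (P : pred quad) F : int :=
  \sum_(t | quad_ok t && P t) F (qa t) (qb t).

(* a x + b y = (a - b) x + b (x + y). *)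
Lemma quad_sum_shift F :
  quad_sum (fun t => (qb t < qa t)%N) (fun a b => F (a - b)%N b) =
  quad_sum (fun t => (qx t < qy t)%N) F.
Proof.
apply: (@big_bij _ _ _ _ _
  (fun t : quad => (inord (qa t - qb t), t.1.1.2, t.1.2, inord (qx t + qy t)))
  (fun t : quad => (inord (qa t + qb t), t.1.1.2, t.1.2, inord (qy t - qx t)))).
- move=> [[[a b] x] y]; have [aN bN] := (ltn_ord a, ltn_ord b).
  have [xN yN] := (ltn_ord x, ltn_ord y) => /andP[/and5P[a0 b0 x0 y0 /eqP E]]; rewrite /qa /qb /qx /qy /= => ba.
  have xyN : (x + y < N.+1)%N by nia.
  have abN : (a - b < N.+1)%N by nia.
  split; last first.
    rewrite !inordK //; congr (_, _, _, _); apply: val_inj; rewrite /= inordK; lia.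
  rewrite !inordK //; apply/andP; split; last by lia.
  by apply/and5P; split; rewrite ?inordK //; try lia; apply/eqP; nia.
- move=> [[[a b] x] y]; have [aN bN] := (ltn_ord a, ltn_ord b).
  have [xN yN] := (ltn_ord x, ltn_ord y) => /andP[/and5P[a0 b0 x0 y0 /eqP E]]; rewrite /qa /qb /qx /qy /= => ba.
  have xyN : (a + b < N.+1)%N by nia.
  have abN : (y - x < N.+1)%N by nia.
  split; last first.
    rewrite !inordK //; congr (_, _, _, _); apply: val_inj; rewrite /= inordK; lia.
  rewrite !inordK //; apply/andP; split; last by lia.
  by apply/and5P; split; rewrite ?inordK //; try lia; apply/eqP; nia.
- move=> [[[a b] x] y] _; rewrite /qa /qb /qx /qy /= inordK //.
  by rewrite (leq_ltn_trans _ (ltn_ord a)) ?leq_subr.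
Qed.

Lemma quad_sum_swap (P : pred quad) F :
  quad_sum P F =
  quad_sum (fun t => P (t.1.1.2, t.1.1.1, t.2, t.1.2)) (fun a b => F b a).
Proof.
apply: (@big_bij _ _ _ _ _
  (fun t : quad => (t.1.1.2, t.1.1.1, t.2, t.1.2))
  (fun t : quad => (t.1.1.2, t.1.1.1, t.2, t.1.2))).
- move=> [[[a b] x] y]; have [aN bN] := (ltn_ord a, ltn_ord b).
  have [xN yN] := (ltn_ord x, ltn_ord y) => /andP[/and5P[a0 b0 x0 y0 E] Pt]; split=> //=.
  by rewrite Pt andbT a0 b0 x0 y0 addnC.
- move=> [[[a b] x] y]; have [aN bN] := (ltn_ord a, ltn_ord b).
  have [xN yN] := (ltn_ord x, ltn_ord y) => /andP[/and5P[a0 b0 x0 y0 E] Pt]; split=> //=.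
  by rewrite Pt andbT a0 b0 x0 y0 addnC.
- by case=> [[[a b] x] y].
Qed.

Lemma quad_sum_split (u v : quad -> nat) F :
  quad_sum predT F = quad_sum (fun t => (v t < u t)%N) F
    + quad_sum (fun t => (u t < v t)%N) F + quad_sum (fun t => u t == v t) F.
Proof.
rewrite {1}/quad_sum (bigID (fun t => u t == v t)) /= addrC; congr (_ + _).
  rewrite (bigID (fun t => (v t < u t)%N)) /=.
  congr (_ + _); apply: eq_bigl => t;
  by rewrite andbT -andbA; congr (_ && _); case: (ltngtP (u t) (v t)).
by apply: eq_bigl => t; rewrite andbT.
Qed.

(** A Liouville-type argument: split the total sum of [h] once by comparing a with b and once by
    comparing x with y. Swapping doubles the strict parts, and [quad_sum_shift] turns the part x < y
    into the sum of h(a - b, b) over b < a. Equating the two splittings leaves only the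
    diagonals. *)
Lemma quad_sum_symm (h k : nat -> nat -> int) :
  (forall a b, h a b = h b a) -> (forall a b, k a b = k b a) ->
  (forall a b, (b <= a)%N -> k a b = h a b - h (a - b)%N b) ->
  quad_sum predT k = quad_sum (fun t => qx t == qy t) h
    - quad_sum (fun t => qa t == qb t) (fun a b => h 0%N a).
Proof.
move=> hC kC hk.
have ab f : (forall a b, f a b = f b a) ->
    quad_sum predT f = quad_sum (fun t => (qb t < qa t)%N) f *+ 2
      + quad_sum (fun t => qa t == qb t) f.
  move=> fC; rewrite (quad_sum_split qa qb) mulr2n; congr (_ + _ + _).
  by rewrite quad_sum_swap; apply: eq_bigr => t _.
have xy : quad_sum predT h = quad_sum (fun t => (qx t < qy t)%N) h *+ 2
      + quad_sum (fun t => qx t == qy t) h.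
  rewrite (quad_sum_split qx qy) mulr2n; congr (_ + _ + _).
  by rewrite quad_sum_swap; apply: eq_bigr => t _; apply: hC.
have := ab h hC; rewrite xy (ab k kC) -quad_sum_shift => E.
have -> : quad_sum (fun t => (qb t < qa t)%N) k =
    quad_sum (fun t => (qb t < qa t)%N) h
    - quad_sum (fun t => (qb t < qa t)%N) (fun a b => h (a - b)%N b).
  rewrite /quad_sum -sumrB; apply: eq_bigr => t /andP[_ /ltnW]; exact: hk.
have -> : quad_sum (fun t => qa t == qb t) k =
    quad_sum (fun t => qa t == qb t) h
    - quad_sum (fun t => qa t == qb t) (fun a b => h 0%N a).
  rewrite /quad_sum -sumrB; apply: eq_bigr => t /andP[_ /eqP->].
  by rewrite hk // subnn; congr (_ - h _ _).
by move: E; lia.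
Qed.

(** When x = y the equation reads (a + b) x = N: d = a + b is a divisor and a = i runs over 0 < i <
    d. *)
Lemma quad_sum_diag_xy h :
  quad_sum (fun t => qx t == qy t) h =
  divisor_sum (fun d => \sum_(i < d | (0 < i)%N) h i (d - i)%N) N.
Proof.
rewrite /divisor_sum.
transitivity (\sum_(d < N.+1 | (0 < d)%N && (d %| N)%N)
   \sum_(i < N.+1 | (0 < i)%N && (i < d)%N) h i (d - i)%N); last first.
  apply: eq_bigr => d _; symmetry; rewrite (big_ord_widen_cond N.+1 (fun i => 0 < i)%N
    (fun i => h i (d - i)%N)) 1?ltnW //.
rewrite pair_big_dep /=.
apply: (@big_bij _ _ _ _ _
  (fun t : quad => (inord (qa t + qb t), t.1.1.1))
  (fun p : I * I => (p.2, inord (p.1 - p.2), inord (N %/ p.1), inord (N %/ p.1)))).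
- move=> [[[a b] x] y]; have [aN bN] := (ltn_ord a, ltn_ord b).
  have [xN yN] := (ltn_ord x, ltn_ord y) => /andP[/and5P[a0 b0 x0 y0 /eqP E]]; rewrite /qa /qb /qx /qy /=.
  move=> /eqP xy; have EN : N = ((a + b) * x)%N by rewrite -[LHS]E xy mulnDl.
  have abN : (a + b < N.+1)%N by nia.
  have dvN : (a + b %| N)%N by rewrite [X in (_ %| X)%N]EN dvdn_mulr.
  have NE : (N %/ (a + b) = x)%N by rewrite [X in (X %/ _)%N]EN mulKn // addn_gt0 a0.
  rewrite !inordK //; split; first by rewrite dvN /=; lia.
  rewrite NE.
  congr (_, _, _, _); apply: val_inj; rewrite /= inordK //; lia.
- move=> [d i] /=; have [dN1 iN1] := (ltn_ord d, ltn_ord i) => /andP[/andP[d0 dN] /andP[i0 id]].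
  have dN' : (d < N.+1)%N by [].
  have NdN : (N %/ d < N.+1)%N by rewrite ltnS leq_div.
  have E : (N %/ d * d = N)%N by rewrite divnK.
  split.
    by rewrite /qa /qb /qx /qy /= !inordK ?eqxx ?andbT //; lia.
  congr (_, _); apply: val_inj; rewrite /qa /qb /= inordK // ?inordK; lia.
- move=> [[[a b] x] y]; have [aN bN] := (ltn_ord a, ltn_ord b).
  have [xN yN] := (ltn_ord x, ltn_ord y) => /andP[/and5P[a0 b0 x0 y0 /eqP E]]; rewrite /qa /qb /qx /qy /=.
  by move=> /eqP xy; rewrite inordK; [congr h; lia | nia].
Qed.

(** When a = b the equation reads a (x + y) = N: for d = a there are N/d - 1 choices of x, and d
    (N/d - 1) = N - d. *)
Lemma quad_sum_diag_ab (g : nat -> int) :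
  quad_sum (fun t => qa t == qb t) (fun a b => a%:R * g a) =
  divisor_sum (fun d => (N%:R - d%:R) * g d) N.
Proof.
rewrite /divisor_sum.
transitivity (\sum_(d < N.+1 | (0 < d)%N && (d %| N)%N)
   \sum_(i < N.+1 | (0 < i)%N && (i < N %/ d)%N) d%:R * g d); last first.
  apply: eq_bigr => d /andP[d0 dN].
  rewrite -(big_ord_widen_cond N.+1 (fun i => 0 < i)%N (fun i => d%:R * g d)); last first.
    by rewrite leqW // leq_div.
  have := divnK dN; case: (N %/ d)%N => [|m]; first by move: (ltn_ord d); lia.
  rewrite big_mkcond big_ord_recl /= add0r sumr_const card_ord => E.
  by rewrite -[X in (X%:R - _) * _]E natrM -mulr_natl -natr1; ring.
rewrite pair_big_dep /=.
apply: (@big_bij _ _ _ _ _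
  (fun t : quad => (t.1.1.1, t.1.2))
  (fun p : I * I => (p.1, p.1, p.2, inord (N %/ p.1 - p.2)))).
- move=> [[[a b] x] y]; have [aN bN] := (ltn_ord a, ltn_ord b).
  have [xN yN] := (ltn_ord x, ltn_ord y) => /andP[/and5P[a0 b0 x0 y0 /eqP E]]; rewrite /qa /qb /qx /qy /=.
  move=> /eqP xy; have EN : N = (a * (x + y))%N by rewrite -[LHS]E xy mulnDr.
  have H : (N %/ a = x + y)%N by rewrite [X in (X %/ _)%N]EN mulKn.
  have dvN : (a %| N)%N by rewrite [X in (_ %| X)%N]EN dvdn_mulr.
  split; first by rewrite H dvN /=; lia.
  rewrite H; congr (_, _, _, _); apply: val_inj; rewrite /= ?inordK //; lia.
- move=> [d i] /=; have [dN1 iN1] := (ltn_ord d, ltn_ord i) => /andP[/andP[d0 dN] /andP[i0 id]].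
  have NdN : (N %/ d < N.+1)%N by rewrite ltnS leq_div.
  have E : (N %/ d * d = N)%N by rewrite divnK.
  split=> //; rewrite /qa /qb /qx /qy /= !inordK ?eqxx ?andbT //; lia.
- by [].
Qed.

(** Group the quadruples by m = a x; then a divides m, b divides N - m, and x, y are the
    cofactors. *)
Lemma quad_sum_conv i j :
  quad_sum predT (fun a b => a%:R ^+ i * b%:R ^+ j) =
  \sum_(m < N.+1) sigma i m * sigma j (N - m).
Proof.
transitivity (\sum_(m < N.+1) \sum_(a < N.+1 | [&& (0 < a)%N, (a %| m)%N & (a <= m)%N])
   \sum_(b < N.+1 | [&& (0 < b)%N, (b %| N - m)%N & (b <= N - m)%N])
     a%:R ^+ i * b%:R ^+ j :> int); last first.
  apply: eq_bigr => m _; rewrite /sigma /divisor_sum.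
  rewrite (big_ord_widen_cond N.+1 (fun d => (0 < d)%N && (d %| m)%N) (fun d => d%:R ^+ i)) //.
  rewrite (big_ord_widen_cond N.+1 (fun d => (0 < d)%N && (d %| N - m)%N) (fun d => d%:R ^+ j));
    last by rewrite ltnS leq_subr.
  rewrite mulr_suml; apply: eq_big => [a|a _]; first by rewrite ltnS andbA.
  by rewrite mulr_sumr; apply: eq_bigl => b; rewrite ltnS andbA.
rewrite (pair_big_dep) /= pair_big_dep /=.
apply: (@big_bij _ _ _ _ _
  (fun t : quad => (inord (qa t * qx t), t.1.1.1, t.1.1.2))
  (fun p : I * I * I => (p.1.2, p.2, inord (p.1.1 %/ p.1.2), inord ((N - p.1.1) %/ p.2)))).
- move=> [[[a b] x] y]; have [aN bN] := (ltn_ord a, ltn_ord b).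
  have [xN yN] := (ltn_ord x, ltn_ord y) => /andP[/and5P[a0 b0 x0 y0 /eqP E] _]; rewrite /qa /qb /qx /qy /=.
  have axN : (a * x < N.+1)%N by lia.
  have NE : (N - a * x = b * y)%N by lia.
  rewrite !inordK // NE !dvdn_mulr // a0 b0 /= !mulKn //; split; first by nia.
  by rewrite !inord_val.
- move=> [[m a] b] /= /andP[/and3P[a0 am am'] /and3P[b0 bm bm']].
  have maN : (m %/ a < N.+1)%N by rewrite (leq_ltn_trans (leq_div _ _)).
  have mbN : ((N - m) %/ b < N.+1)%N by rewrite ltnS (leq_trans (leq_div _ _)) ?leq_subr.
  have E1 := divnK am; have E2 := divnK bm.
  have mN : (m < N.+1)%N by [].
  rewrite /qa /qb /qx /qy /= !inordK //; split; last first.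
    by congr (_, _, _); apply: val_inj; rewrite /= mulnC E1 inordK.
  apply/andP; split=> //; rewrite a0 b0 !divn_gt0 // am' bm' /=.
  by rewrite mulnC E1 mulnC E2; apply/eqP; lia.
- by [].
Qed.

End Quadruples.

Arguments quad_sum N P F : clear implicits.

(** Polynomials over the integers replace truncated subtraction. The term i = 0 of the inner sum,
    h(0, d) = d g(d), absorbs the d in the factor N - d. *)
Lemma quad_sum_form (N : nat) (h k : int -> int -> int) (g : int -> int) :
  (forall a b, h a b = h b a) -> (forall a b, k a b = k b a) ->
  (forall a b, k a b = h a b - h (a - b) b) -> (forall a, h 0 a = a * g a) ->
  quad_sum N predT (fun a b => k a%:R b%:R) =
  divisor_sum (fun d => \sum_(i < d) h i%:R (d%:R - i%:R) - N%:R * g d%:R) N.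
Proof.
move=> hC kC hk h0; rewrite (@quad_sum_symm N (fun a b => h a%:R b%:R)); first last.
- by move=> a b le_ba; rewrite hk natrB.
- by move=> a b; apply: kC.
- by move=> a b; apply: hC.
rewrite quad_sum_diag_xy.
have -> : quad_sum N (fun t => qa t == qb t) (fun a b => h 0%:R a%:R) =
    quad_sum N (fun t => qa t == qb t) (fun a b => a%:R * g a%:R).
  by apply: eq_bigr => t _; rewrite h0.
rewrite (quad_sum_diag_ab _ (fun a => g a%:R)) /divisor_sum -sumrB.
apply: eq_bigr => -[[|d] dN] //= _.
rewrite big_mkcond !big_ord_recl /= subr0 h0 add0r.
rewrite (eq_bigr (fun i : 'I_d => h (bump 0 i)%:R (d.+1%:R - (bump 0 i)%:R)));
  last by move=> i _; rewrite natrB // /bump; have := ltn_ord i; lia.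
by rewrite /=; ring.
Qed.

Definition sigma_series (j : nat) : pser int := PSer (sigma j).

Lemma coef_sigma_mul i j N : coef (sigma_series i * sigma_series j) N =
  quad_sum N predT (fun a b => a%:R ^+ i * b%:R ^+ j).
Proof. by rewrite pser_coefM quad_sum_conv. Qed.

Notation S1 := (sigma_series 1).
Notation S3 := (sigma_series 3).
Notation S5 := (sigma_series 5).
Notation S7 := (sigma_series 7).

(* The upper bound m and the parameter D are kept apart so that induction on m
   applies; the closed forms are used at D = m. *)
Lemma sum_form2 (m : nat) (D : int) :
  6%:R * \sum_(i < m) (i%:R ^+ 2 + i%:R * (D - i%:R) + (D - i%:R) ^+ 2) =
  2%:R * m%:R ^+ 3 - 3%:R * m%:R ^+ 2 * (D + 1)
    + m%:R * (6%:R * D ^+ 2 + 3%:R * D + 1).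
Proof.
elim: m => [|m IHm]; first by rewrite big_ord0; ring.
by rewrite big_ord_recr mulrDr IHm /= -natr1; ring.
Qed.

Lemma sum_form4 (m : nat) (D : int) :
  30%:R * \sum_(i < m) (i%:R ^+ 2 + i%:R * (D - i%:R) + (D - i%:R) ^+ 2) ^+ 2 =
  6%:R * m%:R ^+ 5 - 15%:R * m%:R ^+ 4 * (D + 1)
    + 10%:R * m%:R ^+ 3 * (3%:R * D ^+ 2 + 3%:R * D + 1)
    - 15%:R * m%:R ^+ 2 * (2%:R * D ^+ 3 + 3%:R * D ^+ 2 + D)
    + m%:R * (30%:R * D ^+ 4 + 30%:R * D ^+ 3 + 15%:R * D ^+ 2 - 1).
Proof.
elim: m => [|m IHm]; first by rewrite big_ord0; ring.
by rewrite big_ord_recr mulrDr IHm /= -natr1; ring.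
Qed.

Lemma sum_form6 (m : nat) (D : int) :
  30%:R * \sum_(i < m) i%:R ^+ 2 * (D - i%:R) ^+ 2 * D ^+ 2 =
  D ^+ 2 * (6%:R * m%:R ^+ 5 - 15%:R * m%:R ^+ 4 * (D + 1)
    + 10%:R * m%:R ^+ 3 * (D ^+ 2 + 3%:R * D + 1)
    - 15%:R * m%:R ^+ 2 * (D ^+ 2 + D) + m%:R * (5%:R * D ^+ 2 - 1)).
Proof.
elim: m => [|m IHm]; first by rewrite big_ord0; ring.
by rewrite big_ord_recr mulrDr IHm /= -natr1; ring.
Qed.

Lemma sum_form6' (m : nat) (D : int) :
  2%:R * \sum_(i < m)
    (42%:R * (i%:R ^+ 2 + i%:R * (D - i%:R) + (D - i%:R) ^+ 2) ^+ 3
     - 147%:R * (i%:R ^+ 2 * (D - i%:R) ^+ 2 * D ^+ 2)) =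
  12%:R * m%:R ^+ 7 - 42%:R * m%:R ^+ 6 * (D + 1)
    + 42%:R * m%:R ^+ 5 * (D ^+ 2 + 3%:R * D + 1)
    - 105%:R * m%:R ^+ 4 * (D ^+ 2 + D)
    + 14%:R * m%:R ^+ 3 * (5%:R * D ^+ 4 + 5%:R * D ^+ 2 - 1)
    - 21%:R * m%:R ^+ 2 * (6%:R * D ^+ 5 + 5%:R * D ^+ 4 - D)
    + m%:R * (84%:R * D ^+ 6 + 126%:R * D ^+ 5 + 35%:R * D ^+ 4 - 7%:R * D ^+ 2
              + 2%:R).
Proof.
elim: m => [|m IHm]; first by rewrite big_ord0; ring.
by rewrite big_ord_recr mulrDr IHm /= -natr1; ring.
Qed.

Lemma sigmaE (j N : nat) : sigma j N = divisor_sum (fun d => d%:R ^+ j) N.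
Proof. by []. Qed.

Lemma divisor_sumZ (c : int) F N :
  c * divisor_sum F N = divisor_sum (fun d => c * F d) N.
Proof. exact: mulr_sumr. Qed.

Lemma divisor_sumD F G N :
  divisor_sum F N + divisor_sum G N = divisor_sum (fun d => F d + G d) N.
Proof. by rewrite /divisor_sum big_split. Qed.

Lemma divisor_sumN F N : - divisor_sum F N = divisor_sum (fun d => - F d) N.
Proof. by rewrite /divisor_sum sumrN. Qed.

Definition divisor_sum_lin := (divisor_sumZ, divisor_sumN, divisor_sumD).

Lemma divisor_sumE (N : nat) (F G : nat -> int) :
  (forall d, F d = G d) -> divisor_sum F N = divisor_sum G N.
Proof. by move=> FG; apply: eq_bigr. Qed.

Lemma quad_sum_lin (N : nat) (c e : int) F G K :
  (forall a b, K a b = c * F a b + e * G a b) ->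
  quad_sum N predT K = c * quad_sum N predT F + e * quad_sum N predT G.
Proof.
by move=> KE; rewrite /quad_sum !mulr_sumr -big_split; apply: eq_bigr => t _.
Qed.

Lemma sigma1_sigma1 : 12%:R * (S1 * S1) = 5%:R * S3 + S1 - 6%:R * theta S1.
Proof.
apply: pserP => N.
rewrite pser_coefB pser_coefD !coef_natl coef_theta coef_sigma_mul.
(* For h = a^2 + a b + b^2 the difference h(a, b) - h(a - b, b) is 2 a b; the term N g(d) produces
   [theta S1]. *)
have := @quad_sum_form N (fun a b => a ^+ 2 + a * b + b ^+ 2)
  (fun a b => 2%:R * a * b) (fun a => a).
rewrite (@quad_sum_lin N 2%:R 0 (fun a b => a%:R ^+ 1 * b%:R ^+ 1) (fun _ _ => 0));
  last by move=> a b; ring.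
move=> E; have {E} E := E ltac:(move=> a b; ring) ltac:(move=> a b; ring)
  ltac:(move=> a b; ring) ltac:(move=> a; ring).
transitivity (6%:R * (2%:R * quad_sum N predT (fun a b => a%:R ^+ 1 * b%:R ^+ 1))
  : int); first by ring.
move: E; rewrite mul0r addr0 => ->; rewrite /= !sigmaE !divisor_sum_lin.
by apply: divisor_sumE => d; rewrite mulrBr sum_form2; ring.
Qed.

Lemma sigma1_sigma3 :
  240%:R * (S1 * S3) = 21%:R * S5 + 10%:R * S3 - 30%:R * theta S3 - S1.
Proof.
apply: pserP => N.
rewrite !pser_coefB pser_coefD !coef_natl coef_theta coef_sigma_mul.
have E13 : quad_sum N predT (fun a b => a%:R ^+ 3 * b%:R ^+ 1) =
    quad_sum N predT (fun a b => a%:R ^+ 1 * b%:R ^+ 3) :> int.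
  by rewrite quad_sum_swap; apply: eq_bigr => t _; rewrite mulrC.
(* The forms a^2 + a b + b^2 and a^2 - a b + b^2 differ by 2 a b and add up to 2 (a^2 + b^2). *)
have := @quad_sum_form N (fun a b => (a ^+ 2 + a * b + b ^+ 2) ^+ 2)
  (fun a b => 4%:R * a * b * (a ^+ 2 + b ^+ 2)) (fun a => a ^+ 3).
rewrite (@quad_sum_lin N 4%:R 4%:R (fun a b => a%:R ^+ 1 * b%:R ^+ 3)
  (fun a b => a%:R ^+ 3 * b%:R ^+ 1)); last by move=> a b; ring.
move=> E; have {E} E := E ltac:(move=> a b; ring) ltac:(move=> a b; ring)
  ltac:(move=> a b; ring) ltac:(move=> a; ring).
move: E; rewrite E13; set q := quad_sum _ _ _ => E.
have -> : 240%:R * q = 30%:R * (4%:R * q + 4%:R * q) by ring.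
rewrite E /= !sigmaE !divisor_sum_lin.
by apply: divisor_sumE => d; rewrite mulrBr sum_form4; ring.
Qed.

Lemma sigma3_sigma3 : 120%:R * (S3 * S3) = S7 - S3.
Proof.
apply: pserP => N.
rewrite pser_coefB !coef_natl coef_sigma_mul.
(* Since h(0, a) = 0 here, no derivative appears; the difference is a^2 b^2 ((a + b)^2 - (a -
   b)^2). *)
have := @quad_sum_form N (fun a b => a ^+ 2 * b ^+ 2 * (a + b) ^+ 2)
  (fun a b => 4%:R * a ^+ 3 * b ^+ 3) (fun a => 0).
rewrite (@quad_sum_lin N 4%:R 0 (fun a b => a%:R ^+ 3 * b%:R ^+ 3)
  (fun _ _ => 0)); last by move=> a b; ring.
move=> E; have {E} E := E ltac:(move=> a b; ring) ltac:(move=> a b; ring)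
  ltac:(move=> a b; ring) ltac:(move=> a; ring).
move: E; set q := quad_sum _ _ _ => E.
have -> : 120%:R * q = 30%:R * (4%:R * q + 0 * quad_sum N predT (fun _ _ => 0)) by ring.
rewrite E /= !sigmaE !divisor_sum_lin.
apply: divisor_sumE => d; rewrite mulr0 subr0.
under eq_bigr => i _ do rewrite addrCA subrr addr0.
by rewrite sum_form6; ring.
Qed.

Lemma sigma1_sigma5 :
  504%:R * (S1 * S5) = 20%:R * S7 + 21%:R * S5 - 42%:R * theta S5 + S1.
Proof.
apply: pserP => N.
rewrite pser_coefD pser_coefB pser_coefD !coef_natl coef_theta coef_sigma_mul.
have E15 : quad_sum N predT (fun a b => a%:R ^+ 5 * b%:R ^+ 1) =
    quad_sum N predT (fun a b => a%:R ^+ 1 * b%:R ^+ 5) :> int.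
  by rewrite quad_sum_swap; apply: eq_bigr => t _; rewrite mulrC.
(* The two parts of h have differences 6 a b (a^2 + b^2)^2 + 2 a^3 b^3 and 4 a^3 b^3; the weights 42
   and -147 cancel the a^3 b^3 terms. *)
have := @quad_sum_form N
  (fun a b => 42%:R * (a ^+ 2 + a * b + b ^+ 2) ^+ 3
     - 147%:R * (a ^+ 2 * b ^+ 2 * (a + b) ^+ 2))
  (fun a b => 252%:R * a * b * (a ^+ 4 + b ^+ 4)) (fun a => 42%:R * a ^+ 5).
rewrite (@quad_sum_lin N 252%:R 252%:R (fun a b => a%:R ^+ 1 * b%:R ^+ 5)
  (fun a b => a%:R ^+ 5 * b%:R ^+ 1)); last by move=> a b; ring.
move=> E; have {E} E := E ltac:(move=> a b; ring) ltac:(move=> a b; ring)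
  ltac:(move=> a b; ring) ltac:(move=> a; ring).
move: E; rewrite E15; set q := quad_sum _ _ _ => E.
apply: (@mulfI _ 2%:R) => //.
have -> : 2%:R * (504%:R * q) = 2%:R * (252%:R * q + 252%:R * q) by ring.
rewrite E /= !sigmaE !divisor_sum_lin.
apply: divisor_sumE => d; rewrite mulrBr.
under eq_bigr => i _ do rewrite [i%:R + _]addrCA subrr addr0.
by rewrite sum_form6'; ring.
Qed.

Definition eisP : pser int := 1 - 24%:R * S1.
Definition eisQ : pser int := 1 + 240%:R * S3.
Definition eisR : pser int := 1 - 504%:R * S5.

(** Lets [ring] deduce an equation from a known one by comparing the differences of their sides. *)
Lemma eq_from_sub (V : zmodType) (u v x y : V) : u = v -> x - y = u - v -> x = y.
Proof. by move=> -> /eqP; rewrite subrr subr_eq0 => /eqP. Qed.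

Lemma theta_eisP : 12%:R * theta eisP = eisP ^+ 2 - eisQ.
Proof.
rewrite /eisP /eisQ raddfB /= theta1 theta_natl.
move: (theta S1) S1 S3 sigma1_sigma1 => t1 s1 s3 /(congr1 ( *%R (- 48%:R))) E.
by apply: (eq_from_sub E); ring.
Qed.

Lemma theta_eisQ : 3%:R * theta eisQ = eisP * eisQ - eisR.
Proof.
rewrite /eisP /eisQ /eisR raddfD /= theta1 theta_natl.
move: (theta S3) S1 S3 S5 sigma1_sigma3 => t3 s1 s3 s5 /(congr1 ( *%R 24%:R)) E.
by apply: (eq_from_sub E); ring.
Qed.

Lemma theta_eisR : 2%:R * theta eisR = eisP * eisR - eisQ ^+ 2.
Proof.
rewrite /eisP /eisQ /eisR raddfB /= theta1 theta_natl.
move: (theta S5) S1 S3 S5 S7 sigma1_sigma5 sigma3_sigma3 => t5 s1 s3 s5 s7.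
(* This combination eliminates [S7]: -24 * 20 + 480 = 0. *)
move=> /(congr1 ( *%R (- 24%:R))) E15 /(congr1 ( *%R 480%:R)) E33.
by apply: (eq_from_sub (congr2 +%R E15 E33)); ring.
Qed.

(** * Reflected polynomials in P, Q, R modulo 289 *)

(* ((i, j, k), c) stands for c P^i Q^j R^k. *)
Definition monomial := (nat * nat * nat)%type.
Definition poly3 := seq (monomial * N).

Definition poly3_insert (t : monomial * N) : poly3 -> poly3 :=
  fix insert p := if p is u :: p' then
    if u.1 == t.1 then (t.1, N.modulo (N.add t.2 u.2) 289) :: p' else u :: insert p'
  else [:: t].

Definition poly3_add (p q : poly3) : poly3 :=
  foldr (fun t r => if t.2 is N0 then r else poly3_insert t r) q p.

Definition term_mul (t u : monomial * N) : monomial * N :=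
  ((t.1.1.1 + u.1.1.1, t.1.1.2 + u.1.1.2, t.1.2 + u.1.2)%N,
   N.modulo (N.mul t.2 u.2) 289).

Definition poly3_mul (p q : poly3) : poly3 :=
  foldr (fun t r => poly3_add (map (term_mul t) q) r) [::] p.

Definition poly3_const (c : N) : poly3 := [:: ((0, 0, 0)%N, c)].

Definition poly3_exp (p : poly3) (n : nat) : poly3 :=
  iter n (poly3_mul p) (poly3_const 1).

Definition poly3_opp (p : poly3) : poly3 := poly3_mul (poly3_const 288) p.

Definition term_deriv (dx dy dz : poly3) (t : monomial * N) : poly3 :=
  let: ((i, j, k), c) := t in
  let scaled u e := [:: (u, N.modulo (N.mul c (N.of_nat e)) 289)] in
  poly3_add (poly3_mul (scaled (i.-1, j, k) i) dx)
    (poly3_add (poly3_mul (scaled (i, j.-1, k) j) dy)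
      (poly3_mul (scaled (i, j, k.-1) k) dz)).

Definition poly3_deriv (dx dy dz p : poly3) : poly3 :=
  foldr (fun t r => poly3_add (term_deriv dx dy dz t) r) [::] p.

(** Cancelled monomials stay in the list with coefficient 0, so every coefficient is tested. As
    [poly3_opp] multiplies by 288, the test is meaningful for divisors M of 289. *)
Definition poly3_eqmod (M : N) (p q : poly3) : bool :=
  all (fun t : monomial * N => N.eqb (N.modulo t.2 M) 0) (poly3_add p (poly3_opp q)).

Section Eval.
Variables (S : comNzRingType) (x y z : S).
Hypothesis char289 : 289%:R = 0 :> S.

Definition mono_eval (m : monomial) : S := x ^+ m.1.1 * y ^+ m.1.2 * z ^+ m.2.

Definition poly3_eval (p : poly3) : S :=
  \sum_(t <- p) (N.to_nat t.2)%:R * mono_eval t.1.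

Lemma natr_modN c M : (N.to_nat c)%:R =
  (N.to_nat (N.div c M))%:R * (N.to_nat M)%:R + (N.to_nat (N.modulo c M))%:R :> S.
Proof.
rewrite -natrM -natrD; congr _%:R.
by rewrite {1}(N.div_mod' c M) N2Nat.inj_add N2Nat.inj_mul mulnC.
Qed.

Lemma natr_mod289 c : (N.to_nat (N.modulo c 289))%:R = (N.to_nat c)%:R :> S.
Proof. by rewrite (natr_modN c 289) [X in _ * X]char289 mulr0 add0r. Qed.

Lemma poly3_eval_cons t p :
  poly3_eval (t :: p) = (N.to_nat t.2)%:R * mono_eval t.1 + poly3_eval p.
Proof. by rewrite /poly3_eval big_cons. Qed.

Lemma poly3_eval_seq1 t : poly3_eval [:: t] = (N.to_nat t.2)%:R * mono_eval t.1.
Proof. by rewrite /poly3_eval big_seq1. Qed.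

Lemma poly3_eval_insert t p :
  poly3_eval (poly3_insert t p) = (N.to_nat t.2)%:R * mono_eval t.1 + poly3_eval p.
Proof.
elim: p => [|u p IHp]; first by rewrite poly3_eval_cons.
rewrite /=; case: eqP => [ut|_]; rewrite !poly3_eval_cons.
  by rewrite ut natr_mod289 N2Nat.inj_add natrD mulrDl addrA.
by rewrite IHp addrCA.
Qed.

Lemma poly3_evalD p q : poly3_eval (poly3_add p q) = poly3_eval p + poly3_eval q.
Proof.
elim: p => [|t p IHp] /=; first by rewrite {2}/poly3_eval big_nil add0r.
rewrite poly3_eval_cons -addrA -IHp; case: t => m [|c] /=.
  by rewrite mul0r add0r.
exact: poly3_eval_insert.
Qed.

Lemma poly3_eval_term t p : poly3_eval (map (term_mul t) p) =
  (N.to_nat t.2)%:R * mono_eval t.1 * poly3_eval p.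
Proof.
rewrite /poly3_eval big_map mulr_sumr; apply: eq_bigr => u _ /=.
rewrite natr_mod289 N2Nat.inj_mul natrM /mono_eval /= !exprD; ring.
Qed.

Lemma poly3_evalM p q : poly3_eval (poly3_mul p q) = poly3_eval p * poly3_eval q.
Proof.
elim: p => [|t p IHp] /=; first by rewrite /poly3_eval !big_nil mul0r.
by rewrite poly3_evalD IHp poly3_eval_term poly3_eval_cons mulrDl.
Qed.

Lemma poly3_eval_const c : poly3_eval (poly3_const c) = (N.to_nat c)%:R.
Proof. by rewrite /poly3_eval big_seq1 /mono_eval /= !mulr1. Qed.

Lemma poly3_evalX p n : poly3_eval (poly3_exp p n) = poly3_eval p ^+ n.
Proof.
elim: n => [|n IHn]; first by rewrite poly3_eval_const.
by rewrite /poly3_exp iterS poly3_evalM IHn exprS.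
Qed.

Lemma poly3_evalN p : poly3_eval (poly3_opp p) = - poly3_eval p.
Proof.
rewrite poly3_evalM poly3_eval_const.
have -> : (N.to_nat 288)%:R = -1 :> S.
  by apply/eqP; rewrite eq_sym -subr_eq0 -opprD oppr_eq0 addrC natr1 char289.
by rewrite mulN1r.
Qed.

(** A congruence modulo M becomes an equality after multiplication by k; the pairs (M, k) in use are
    (289, 1) and (17, 17). *)
Lemma poly3_eqmodP (M : N) (k : S) p q : k * (N.to_nat M)%:R = 0 ->
  poly3_eqmod M p q -> k * poly3_eval p = k * poly3_eval q.
Proof.
move=> kM /allP pq; apply/eqP; rewrite -subr_eq0 -mulrBr -poly3_evalN -poly3_evalD.
apply/eqP; rewrite /poly3_eval mulr_sumr big1_seq // => t /andP[_ /pq /N.eqb_spec t0].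
rewrite (natr_modN t.2 M) t0 addr0; set a := _%:R; set m := mono_eval _.
by have -> : k * (a * (N.to_nat M)%:R * m) = a * m * (k * (N.to_nat M)%:R)
  by [ring]; rewrite kM mulr0.
Qed.

Variables (th : {additive S -> S}) (k : nat) (dx dy dz : poly3).
Hypothesis thM : forall u v, th (u * v) = th u * v + u * th v.
Hypothesis th_x : k%:R * th x = k%:R * poly3_eval dx.
Hypothesis th_y : k%:R * th y = k%:R * poly3_eval dy.
Hypothesis th_z : k%:R * th z = k%:R * poly3_eval dz.

Lemma derivation_natl n u : th (n%:R * u) = n%:R * th u.
Proof. by rewrite !mulr_natl raddfMn. Qed.

Lemma derivationX u n : th (u ^+ n) = n%:R * u ^+ n.-1 * th u.
Proof.
elim: n => [|n IHn].
  rewrite mulr0n !mul0r; apply: (addrI (th 1)).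
  by have := thM 1 1; rewrite !mulr1 mul1r addr0 => <-.
rewrite exprS thM IHn /=; case: n {IHn} => [|n] /=; first by ring.
by rewrite exprS; ring.
Qed.

(** A derivation is determined by its values on the generators. The factor k serves both exact
    values (k = 1) and values known only modulo 17 (k = 17). *)
Lemma poly3_eval_deriv p :
  k%:R * th (poly3_eval p) = k%:R * poly3_eval (poly3_deriv dx dy dz p).
Proof.
elim: p => [|[[[i j] l] c] p IHp]; first by rewrite /poly3_eval !big_nil raddf0.
rewrite poly3_eval_cons raddfD mulrDr IHp.
rewrite -[poly3_deriv _ _ _ (_ :: _)]/(poly3_add (term_deriv dx dy dz (i, j, l, c)) _).
rewrite (poly3_evalD (term_deriv _ _ _ _)).
rewrite mulrDr; congr (_ + _); rewrite derivation_natl /term_deriv.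
have scaled m e : poly3_eval [:: (m, N.modulo (N.mul c (N.of_nat e)) 289)] =
    (N.to_nat c)%:R * e%:R * mono_eval m.
  by rewrite /poly3_eval big_seq1 natr_mod289 N2Nat.inj_mul natrM Nat2N.id.
rewrite 2!(poly3_evalD (poly3_mul _ _)) !poly3_evalM !scaled /mono_eval !thM !derivationX.
rewrite ![fst _]/= ![snd _]/=.
have -> : k%:R * ((N.to_nat c)%:R *
    ((i%:R * x ^+ i.-1 * th x * y ^+ j + x ^+ i * (j%:R * y ^+ j.-1 * th y)) * z ^+ l +
     x ^+ i * y ^+ j * (l%:R * z ^+ l.-1 * th z))) =
  (N.to_nat c)%:R * i%:R * x ^+ i.-1 * y ^+ j * z ^+ l * (k%:R * th x) +
  (N.to_nat c)%:R * j%:R * x ^+ i * y ^+ j.-1 * z ^+ l * (k%:R * th y) +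
  (N.to_nat c)%:R * l%:R * x ^+ i * y ^+ j * z ^+ l.-1 * (k%:R * th z) by ring.
by rewrite th_x th_y th_z; ring.
Qed.

Lemma poly3_eval_iter_deriv n p : k%:R * iter n th (poly3_eval p) =
  k%:R * poly3_eval (iter n (poly3_deriv dx dy dz) p).
Proof.
elim: n => [//|n IHn]; rewrite !iterS -derivation_natl IHn derivation_natl.
exact: poly3_eval_deriv.
Qed.

End Eval.

Declare Scope poly3_scope.
Delimit Scope poly3_scope with P3.
Infix "+" := poly3_add : poly3_scope.
Infix "*" := poly3_mul : poly3_scope.
Infix "^" := poly3_exp : poly3_scope.
Notation "- p" := (poly3_opp p) : poly3_scope.
Notation "p - q" := (poly3_add p (poly3_opp q)) : poly3_scope.
Notation "c %:P3" := (poly3_const c%num) (at level 2, format "c %:P3") : poly3_scope.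
Bind Scope poly3_scope with poly3.

Definition pP : poly3 := [:: ((1, 0, 0)%N, 1%num)].
Definition pQ : poly3 := [:: ((0, 1, 0)%N, 1%num)].
Definition pR : poly3 := [:: ((0, 0, 1)%N, 1%num)].

(** * Polynomial identities modulo 17 and 289, checked by computation *)

Section PolynomialIdentities.

Local Open Scope poly3_scope.

(* 265, 193 and 145 are the inverses of 12, 3 and 2 modulo 289. *)
Definition pdeltaP := 265%:P3 * (pP ^ 2 - pQ).
Definition pdeltaQ := 193%:P3 * (pP * pQ - pR).
Definition pdeltaR := 145%:P3 * (pP * pR - pQ ^ 2).

Definition pD := poly3_deriv pdeltaP pdeltaQ pdeltaR.

(* 48 is the inverse of 1728 modulo 289. *)
Definition pDelta := 48%:P3 * (pQ ^ 3 - pR ^ 2).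
(* Modulo 17, pA and pB are the Eisenstein series of weights 16 and 18. *)
Definition pA := pQ * (8%:P3 * pQ ^ 3 + 10%:P3 * pR ^ 2).
Definition pB := pR * (7%:P3 * pQ ^ 3 + 11%:P3 * pR ^ 2).
(** [pf], [pT] and [pN] are the polynomials f, T and N of the opening sketch, of weights 12, 16 and
    20; [pT] and [pN] are sorted by powers of P. *)
Definition pf := 11%:P3 * pQ ^ 3 + 15%:P3 * pR ^ 2.

Definition pT0 := 10%:P3 * pQ * pR ^ 2 + 10%:P3 * pQ ^ 4.
Definition pT1 := 16%:P3 * pQ ^ 2 * pR.
Definition pT2 := 3%:P3 * pR ^ 2 + 9%:P3 * pQ ^ 3.
Definition pT := pT0 + pP * pT1 + pP ^ 2 * pT2.

Definition pN0 := 9%:P3 * pQ ^ 2 * pR ^ 2 + 10%:P3 * pQ ^ 5.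
Definition pN1 := 7%:P3 * pR ^ 3 + 6%:P3 * pQ ^ 3 * pR.
Definition pN2 := 3%:P3 * pQ * pR ^ 2 + 16%:P3 * pQ ^ 4.
Definition pN := pN0 + pP * pN1 + pP ^ 2 * pN2.

Definition pu := pDelta * (6%:P3 * pQ ^ 3 + 7%:P3 * pR ^ 2).

(* The derivation theta modulo 17, where P = B and 1 = A: these substitutions make
   all the terms homogeneous, so that identities between series become identities
   between polynomials in Q and R.  The same applies to pT', pN' and pF'. *)
Definition pD' := poly3_deriv (265%:P3 * (pB ^ 2 - pQ)) (193%:P3 * (pB * pQ - pA * pR))
  (145%:P3 * (pB * pR - pA * pQ ^ 2)).

Definition pT' := pA * (pA ^ 2 * pT0 + pA * (pB * pT1) + pB ^ 2 * pT2).
Definition pN' := pA ^ 2 * pN0 + pA * (pB * pN1) + pB ^ 2 * pN2.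
Definition pF' := pDelta ^ 6 * (pT' - pf * pN').

Lemma pDelta_deriv : poly3_eqmod 289 (pD pDelta) (pP * pDelta).
Proof. by vm_compute. Qed.

(** By [theta16_eP] the left side evaluates to P modulo 17, whence A B = P; this is the starting
    point for A = 1 and B = P. *)
Lemma theta16_P : poly3_eqmod 17 (iter 16 pD pP + pP ^ 17) (pA * pB).
Proof. by vm_compute. Qed.

Lemma deriv_A : poly3_eqmod 17 (12%:P3 * pD pA) (pB - pP * pA).
Proof. by vm_compute. Qed.

Lemma deriv_B : poly3_eqmod 17 (12%:P3 * pD pB) (pP * pB - pQ * pA).
Proof. by vm_compute. Qed.

(** In weight k, theta^2 g has as coefficient of P the Serre derivative of g times (k + 1)/6, and as
    coefficient of P^2 the form g times k (k + 1)/144. Both vanish modulo 17 when k = -1 modulo 17,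
    as for 16 and 84. In weight 16 the rest is divisible by 17 as well. *)
Lemma deriv2_A : poly3_eqmod 289 (pD (pD pA)) (17%:P3 * pN).
Proof. by vm_compute. Qed.

(** Modulo 17, [pf] solves theta^2 (Delta^6 f) = Delta^6 A, in weight 84 + 4 = 72 + 16; [pT] records
    the remainder divided by 17. *)
Lemma deriv2_f : poly3_eqmod 289 (pD (pD (pDelta ^ 6 * pf)) + 17%:P3 * pDelta ^ 6 * pT)
  (pDelta ^ 6 * pA).
Proof. by vm_compute. Qed.

(** [pD'] raises weights by 18, and the powers of A, which is 1 modulo 17, bring all terms to weight
    424. The term [pu ^ 17] carries the coefficients of F at multiples of 17, which theta^16
    kills. *)
Lemma U_F : poly3_eqmod 17 (iter 16 pD' pF' + pA * pu ^ 17) (pA ^ 18 * pF').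
Proof. by vm_compute. Qed.

Lemma U_u : poly3_eqmod 17 (iter 16 pD' pu) (pA ^ 18 * pu).
Proof. by vm_compute. Qed.

End PolynomialIdentities.

(** * Congruences modulo 17 and the coefficients of Delta^6 *)

Section CoefficientMap.
Variable K : comNzRingType.

Definition map_pser (f : pser int) : pser K := PSer (fun n => (coef f n)%:~R).

Lemma map_pser_is_zmod_morphism : zmod_morphism map_pser.
Proof. by move=> f g; apply: pserP => n /=; rewrite rmorphB. Qed.

Lemma map_pser_is_monoid_morphism : monoid_morphism map_pser.
Proof.
split=> [|f g]; apply: pserP => n; first by case: n.
rewrite /= !pser_coefM rmorph_sum; apply: eq_bigr => i _; exact: rmorphM.
Qed.

HB.instance Definition _ := GRing.isZmodMorphism.Build (pser int) (pser K) map_pser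
  map_pser_is_zmod_morphism.
HB.instance Definition _ := GRing.isMonoidMorphism.Build (pser int) (pser K) map_pser
  map_pser_is_monoid_morphism.

Lemma map_pser_theta f : map_pser (theta f) = theta (map_pser f).
Proof. by apply: pserP => n /=; rewrite rmorphM /= rmorph_nat. Qed.

End CoefficientMap.

(** * Frobenius and Fermat congruences modulo 17 *)

Section Frobenius.
Variable S : comNzRingType.
Hypothesis char289 : 289%:R = 0 :> S.

(* In characteristic 289, congruence modulo 17 is equality after multiplication
   by 17. *)
Lemma Frobenius17D (x y : S) :
  17%:R * (x + y) ^+ 17 = 17%:R * (x ^+ 17 + y ^+ 17).
Proof.
apply/eqP; rewrite -subr_eq0 -mulrBr; apply/eqP; rewrite exprDn.
rewrite big_ord_recl big_ord_recr /= subn0 subnn bin0 binn !expr0 mulr1 mul1r !mulr1n.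
set s := \sum_(i < 16) _.
have -> : x ^+ 17 + (s + y ^+ 17) - (x ^+ 17 + y ^+ 17) = s by ring.
rewrite mulr_sumr big1 // => i _.
have /dvdnP[c ->] : (17 %| 'C(17, bump 0 i))%N.
  by apply: prime_dvd_bin => //; rewrite /bump /= ltnS.
rewrite -[_ *+ (c * 17)]mulr_natr natrM; set m := _ * _ ^+ _.
by have -> : 17%:R * (m * (c%:R * 17%:R)) = 289%:R * (m * c%:R) by [ring];
  rewrite char289 mul0r.
Qed.

Lemma Fermat17 n : 17%:R * n%:R ^+ 17 = 17%:R * n%:R :> S.
Proof.
elim: n => [|n IHn]; first by rewrite expr0n.
by rewrite -[n.+1%:R]natr1 Frobenius17D expr1n !mulrDr IHn.
Qed.

Lemma natr289_inv n : ~~ (17 %| n)%N -> exists m, n%:R * m%:R = 1 :> S.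
Proof.
move=> n17; have cop : coprime n 289.
  by rewrite (_ : 289 = 17 ^ 2)%N // coprimeXr // coprime_sym prime_coprime.
have n0 : (0 < n)%N by case: n n17 {cop}.
case: (egcdnP 289 n0) => km kn E _; exists km; move: E; rewrite (eqP cop) => E.
by rewrite -natrM mulnC E natrD natrM char289 mulr0 add0r.
Qed.

Lemma natr17_dvd n : (17 %| n)%N -> 17%:R * n%:R = 0 :> S.
Proof.
by case/dvdnP=> m ->; rewrite mulnC natrM mulrA -natrM -[(17 * 17)%N]/289%N char289 mul0r.
Qed.

Lemma Fermat16 n : ~~ (17 %| n)%N -> 17%:R * n%:R ^+ 16 = 17%:R :> S.
Proof.
case/natr289_inv=> m nm.
have -> : 17%:R * n%:R ^+ 16 = 17%:R * n%:R ^+ 17 * m%:R :> S.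
  by rewrite exprSr -!mulrA nm mulr1.
by rewrite Fermat17 -mulrA nm mulr1.
Qed.

End Frobenius.

(** * Power series modulo 289 and the coefficients of Delta^6 *)

Section ModSeries.
Variable K : comNzRingType.
Hypothesis char289 : 289%:R = 0 :> K.
(** With [char289] these properties stand for K = Z/289: [ann17] permits division by 17, and [natK]
    extends Fermat's congruence from natural numbers to K. *)
Hypothesis ann17 : forall c : K, 17%:R * c = 0 -> exists d, c = 17%:R * d.
Hypothesis natK : forall c : K, exists n, c = n%:R.

Lemma pser_char289 : 289%:R = 0 :> pser K.
Proof.
by apply: pserP => n; rewrite coef_natmul pser_coef1 -[_ *+ 289]mulr_natl char289 mul0r pser_coef0.
Qed.

Lemma coef_nat m n : coef (m%:R : pser K) n = if n == 0%N then m%:R else 0.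
Proof. by rewrite coef_natmul pser_coef1; case: n => [|n]; rewrite ?mul0rn. Qed.

(** This is g^17 = g(q^17) modulo 17. Writing g = c + q [shift g], Frobenius and Fermat give g^17 =
    c + q^17 ([shift g])^17, and the induction continues at n - 17. *)
Lemma coef_exp17 (g : pser K) n :
  17%:R * coef (g ^+ 17) n = if (17 %| n)%N then 17%:R * coef g (n %/ 17) else 0.
Proof.
elim/ltn_ind: n g => n IHn g; have [c gc] := natK (coef g 0).
have gE : g = c%:R + qX K * shift g.
  by rewrite {1}[g]shiftK gc; congr (_ + _); apply: pserP => -[|j]; rewrite coef_nat.
rewrite -coef_natl {1}gE (Frobenius17D pser_char289) mulrDr (Fermat17 pser_char289).
rewrite pser_coefD !coef_natl coef_nat exprMn coef_qXnM.
case: ltnP => [n17|n17].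
  rewrite mulr0 addr0; case: n n17 {IHn} => [|n] n17; first by rewrite dvdn0 div0n gc.
  by rewrite gtnNdvd // mulr0.
case: n n17 IHn => [//|n] n17 IHn; rewrite mulr0 add0r IHn; last by lia.
rewrite -{3 4}(subnK n17) dvdn_addl // divnDr // divnn /=.
by case: ifP => // _; rewrite addn1.
Qed.

Lemma unit_coef0_reg (f g : pser K) c : coef f 0 * c = 1 -> f * g = 0 -> g = 0.
Proof.
move=> f0 fg; apply: pserP => n; rewrite pser_coef0; elim/ltn_ind: n => n IHn.
have : coef (f * g) n = 0 by rewrite fg pser_coef0.
rewrite pser_coefM big_ord_recl subn0 big1 ?addr0 => [/(congr1 ( *%R c))|i _].
  by rewrite mulr0 mulrA [c * _]mulrC f0 mul1r.
rewrite [X in _ * X]IHn ?mulr0 //= /bump; have := ltn_ord i; lia.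
Qed.

(* Applying 12 theta to A B = P gives (A^2 - 1) (B^2 + Q) = 0 modulo 17. *)
Lemma eisenstein_mod17 (P Q A B : pser K) c :
  17%:R * (A * B) = 17%:R * P ->
  17%:R * (12%:R * theta A) = 17%:R * (B - P * A) ->
  17%:R * (12%:R * theta B) = 17%:R * (P * B - Q * A) ->
  12%:R * theta P = P ^+ 2 - Q ->
  coef ((A + 1) * (B ^+ 2 + Q)) 0 * c = 1 ->
  17%:R * A = 17%:R /\ 17%:R * B = 17%:R * P.
Proof.
move=> AB tA tB tP c1.
have := congr1 (fun u => 12%:R * theta u) AB.
rewrite !theta_natl thetaM; move: (theta A) (theta B) (theta P) tA tB tP.
move=> ta tb tp tA tB tP tAB.
have E1 : 17%:R * (12%:R * ta) * B + A * (17%:R * (12%:R * tb)) =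
    17%:R * (12%:R * tp) by rewrite [RHS]mulrCA -tAB; ring.
rewrite tA tB tP in E1.
have E2 : 17%:R * P ^+ 2 = 17%:R * (A * B) ^+ 2.
  rewrite expr2 mulrA -AB.
  have -> : 17%:R * (A * B) * P = 17%:R * P * (A * B) by ring.
  by rewrite -AB; ring.
have E3 : (A + 1) * (B ^+ 2 + Q) * (17%:R * (A - 1)) = 0.
  by apply: (eq_from_sub (congr2 +%R (esym E1) (esym E2))); ring.
have A17 : 17%:R * A = 17%:R.
  by apply/eqP; rewrite -subr_eq0 -[X in _ - X]mulr1 -mulrBr (unit_coef0_reg c1 E3).
by split=> //; rewrite -AB mulrA A17.
Qed.

Lemma series_div17 (f : pser K) : 17%:R * f = 0 -> exists g, f = 17%:R * g.
Proof.
move=> f17; have ex n : exists d, coef f n = 17%:R * d.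
  by apply: ann17; rewrite -coef_natl f17 pser_coef0.
by case: (choice ex) => g fg; exists (PSer g); apply: pserP => n; rewrite coef_natl fg.
Qed.

(** The reduction of the opening sketch for abstract series: [D6] stands for Delta^6 and [f] for the
    whole product Delta^6 f. *)
Lemma U_Delta6 (A D6 f T N F u : pser K) :
  17%:R * A = 17%:R ->
  theta (theta A) = 17%:R * N ->
  theta (theta f) + 17%:R * (D6 * T) = D6 * A ->
  17%:R * (D6 * T - f * N) = 17%:R * F ->
  17%:R * (iter 16 (@theta K) F + u ^+ 17) = 17%:R * F ->
  17%:R * iter 16 (@theta K) u = 17%:R * u ->
  (forall n, coef D6 (17 * n) = 17%:R * coef u n) /\
  (forall n, coef D6 (289 * n) = 0).
Proof.
move=> A17 ttA ttf F17 UF Uu.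
have [K1 AK] : exists K1, A - 1 = 17%:R * K1.
  by apply: series_div17; rewrite mulrBr A17 mulr1 subrr.
have ttK : 17%:R * theta (theta K1) = 17%:R * N.
  by rewrite -ttA -!theta_natl -AK !raddfB /= theta1 raddf0 subr0.
have D17 : 17%:R * D6 = 17%:R * theta (theta f).
  have -> : 17%:R * D6 = 17%:R * (D6 * A) by rewrite [D6 * A]mulrC mulrA A17.
  have -> : 17%:R * (D6 * A) = 17%:R * theta (theta f) + 289%:R * (D6 * T).
    by rewrite -ttf; ring.
  by rewrite pser_char289 mul0r addr0.
(* Integration by parts: theta W = (theta^2 f) K1 - f theta^2 K1. *)
pose W := theta f * K1 - f * theta K1.
have tW : 17%:R * theta W = 17%:R * D6 * K1 - 17%:R * (f * N).
  rewrite /W raddfB /= !thetaM D17.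
  have -> : 17%:R * (f * N) = f * (17%:R * theta (theta K1)) by rewrite ttK; ring.
  by ring.
have D6E : D6 = theta (theta f) + 17%:R * F - 17%:R * theta W.
  have -> : theta (theta f) = D6 + D6 * (A - 1) - 17%:R * (D6 * T).
    by apply: (eq_from_sub ttf); ring.
  by rewrite AK -F17 tW; ring.
(* At index 17 n, theta^2 f carries the factor (17 n)^2 and 17 theta W the factor 17 * 17 n, both 0
   modulo 289; only 17 F remains. *)
have at17 n : coef D6 (17 * n) = 17%:R * coef u n.
  have n17 : 17%:R * (17 * n)%:R = 0 :> K by rewrite natr17_dvd // dvdn_mulr.
  have at0 m g : 17%:R * ((17 * n)%:R ^+ m.+1 * g) = 0 :> K.
    by rewrite exprS !mulrA n17 !mul0r.
  rewrite D6E pser_coefB pser_coefD !coef_natl !coef_theta.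
  rewrite [17%:R * (_ * coef W _)](at0 0%N) subr0.
  rewrite {1}natrM -mulrA [n%:R * _]mulrC mulrA mulrA n17 !mul0r add0r.
  rewrite -coef_natl -UF mulrDr pser_coefD !coef_natl coef_iter_theta at0 add0r.
  by rewrite coef_exp17 dvdn_mulr // mulKn.
(* At index 17 n the relation u = theta^16 u modulo 17 gives 17 u_(17 n) = 17 (17 n)^16 u_(17 n) =
   0. *)
split=> // n; rewrite -[289%N]/(17 * 17)%N -mulnA at17 -coef_natl -Uu coef_natl.
by rewrite coef_iter_theta exprS !mulrA natr17_dvd ?dvdn_mulr // !mul0r.
Qed.

Definition eP : pser K := map_pser K eisP.
Definition eQ : pser K := map_pser K eisQ.
Definition eR : pser K := map_pser K eisR.
Notation ev := (poly3_eval eP eQ eR).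

Lemma natr_mod m n : (m %% 289 = n %% 289)%N -> m%:R = n%:R :> pser K.
Proof.
move=> mn; rewrite (divn_eq m 289) (divn_eq n 289) mn !natrD !natrM.
by rewrite pser_char289 !mulr0.
Qed.

Lemma ev_P : ev pP = eP.
Proof. by rewrite poly3_eval_seq1 /mono_eval /= !expr0 mul1r !mulr1. Qed.
Lemma ev_Q : ev pQ = eQ.
Proof. by rewrite poly3_eval_seq1 /mono_eval /= !expr0 !mul1r !mulr1. Qed.
Lemma ev_R : ev pR = eR.
Proof. by rewrite poly3_eval_seq1 /mono_eval /= !expr0 !mul1r. Qed.

Lemma evD p q : ev (poly3_add p q) = ev p + ev q.
Proof. exact: (poly3_evalD _ _ _ pser_char289). Qed.
Lemma evM p q : ev (poly3_mul p q) = ev p * ev q.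
Proof. exact: (poly3_evalM _ _ _ pser_char289). Qed.
Lemma evN p : ev (poly3_opp p) = - ev p.
Proof. exact: (poly3_evalN _ _ _ pser_char289). Qed.
Lemma evX p n : ev (poly3_exp p n) = ev p ^+ n.
Proof. exact: (poly3_evalX _ _ _ pser_char289). Qed.
Lemma evC c : ev (poly3_const c) = (N.to_nat c)%:R.
Proof. exact: poly3_eval_const. Qed.
Lemma ev_scaled_sub c p q :
  ev (poly3_mul (poly3_const c) (poly3_add p (poly3_opp q))) =
  (N.to_nat c)%:R * (ev p - ev q).
Proof. by rewrite evM evC evD evN. Qed.
Definition ev_simpl := (evD, evN, evM, evX, evC, ev_P, ev_Q, ev_R).

Lemma mul_from_inverse (c d : nat) (u v : pser K) :
  (c * d = 1 %[mod 289])%N -> c%:R * u = v -> u = d%:R * v.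
Proof. by move=> /natr_mod cd <-; rewrite mulrA -natrM mulnC cd mul1r. Qed.

Lemma theta_eP : theta eP = ev pdeltaP.
Proof.
rewrite /pdeltaP !ev_simpl.
have := congr1 (map_pser K) theta_eisP.
rewrite rmorphM rmorph_nat rmorphB rmorphXn /= map_pser_theta.
by apply: mul_from_inverse.
Qed.

Lemma theta_eQ : theta eQ = ev pdeltaQ.
Proof.
rewrite /pdeltaQ !ev_simpl.
have := congr1 (map_pser K) theta_eisQ.
rewrite rmorphM rmorph_nat rmorphB rmorphM /= map_pser_theta.
by apply: mul_from_inverse.
Qed.

Lemma theta_eR : theta eR = ev pdeltaR.
Proof.
rewrite /pdeltaR !ev_simpl.
have := congr1 (map_pser K) theta_eisR.
rewrite rmorphM rmorph_nat rmorphB rmorphM rmorphXn /= map_pser_theta.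
by apply: mul_from_inverse.
Qed.

Lemma theta_ev p : theta (ev p) = ev (pD p).
Proof.
have := @poly3_eval_deriv _ eP eQ eR pser_char289 (@theta K) 1 _ _ _ (@thetaM K)
  (congr1 _ theta_eP) (congr1 _ theta_eQ) (congr1 _ theta_eR) p.
by rewrite !mul1r.
Qed.

Lemma iter_theta_ev n p : iter n (@theta K) (ev p) = ev (iter n pD p).
Proof. by elim: n => // n IHn; rewrite !iterS IHn theta_ev. Qed.

Lemma ev_eq289 p q : poly3_eqmod 289 p q -> ev p = ev q.
Proof.
move=> pq; have k289 : 1 * (N.to_nat 289)%:R = 0 :> pser K.
  by rewrite mul1r; exact: pser_char289.
have := @poly3_eqmodP _ eP eQ eR pser_char289 _ 1 _ _ k289 pq.
by rewrite !mul1r.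
Qed.

Lemma ev_eq17 p q : poly3_eqmod 17 p q -> 17%:R * ev p = 17%:R * ev q.
Proof.
apply: (@poly3_eqmodP _ eP eQ eR pser_char289).
by rewrite -natrM; exact: pser_char289.
Qed.

(** Divisors divisible by 17 contribute 0 modulo 17, and 17 m and m have the same divisors prime to
    17. *)
Lemma sigma1_mul17 m : (0 < m)%N ->
  17%:R * (sigma 1 (17 * m))%:~R = 17%:R * (sigma 1 m)%:~R :> K.
Proof.
move=> m0; pose s n : K := \sum_(d < n.+1 | (0 < d)%N && (d %| n)%N && ~~ (17 %| d)%N) d%:R.
have sE n : 17%:R * (sigma 1 n)%:~R = 17%:R * s n :> K.
  rewrite /sigma /divisor_sum (bigID (fun d : 'I_n.+1 => (17 %| d)%N)) /=.
  rewrite rmorphD !rmorph_sum /= mulrDr mulr_sumr big1 ?add0r => [|d /andP[_ d17]].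
    by congr (_ * _); apply: eq_bigr => d _; rewrite expr1 rmorph_nat.
  by rewrite expr1 rmorph_nat natr17_dvd.
rewrite !sE; congr (_ * _); rewrite /s.
rewrite [RHS](big_ord_widen_cond (17 * m).+1
  (fun d => (0 < d)%N && (d %| m)%N && ~~ (17 %| d)%N) (fun d => d%:R)); last by lia.
apply: eq_bigl => d; rewrite ltnS.
case d17 : (17 %| d)%N; first by rewrite !andbF.
have -> : (d %| 17 * m)%N = (d %| m)%N.
  by rewrite Gauss_dvdr // coprime_sym prime_coprime ?d17.
case dm : (d %| m)%N; last by rewrite !andbF.
by rewrite (dvdn_leq m0 dm) !andbT.
Qed.

Lemma coef_eP n : coef eP n = (n == 0%N)%:R - 24%:R * (sigma 1 n)%:~R.
Proof.
rewrite -[coef eP n]/((coef eisP n)%:~R) pser_coefB pser_coef1 coef_natl.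
by rewrite rmorphB rmorphM !rmorph_nat.
Qed.

(** At n prime to 17, n^16 = 1 and P^17 contributes 0. At n = 17 m, theta^16 contributes 0 and P^17
    gives the coefficient of P at m, which agrees with that at 17 m by [sigma1_mul17]. *)
Lemma theta16_eP : 17%:R * (iter 16 (@theta K) eP + eP ^+ 17) = 17%:R * eP.
Proof.
apply: pserP => n; rewrite mulrDr pser_coefD !coef_natl coef_exp17 coef_iter_theta mulrA.
case: ifP => [n17|/negbT n17]; last by rewrite (Fermat16 char289 n17) addr0.
case/dvdnP: n17 => m ->; rewrite mulnK // exprS.
have -> : 17%:R * ((m * 17)%:R * (m * 17)%:R ^+ 15) = 0 :> K.
  by rewrite mulrA natr17_dvd ?mul0r // dvdn_mull.
rewrite mul0r add0r !coef_eP muln_eq0 orbF.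
case: posnP => [-> //|m0]; rewrite !sub0r !mulrN; congr (- _).
by rewrite mulrCA [RHS]mulrCA -(sigma1_mul17 m0) mulnC.
Qed.



Lemma mulr17_mod (x x' y y' : pser K) :
  17%:R * x = 17%:R * x' -> 17%:R * y = 17%:R * y' ->
  17%:R * (x * y) = 17%:R * (x' * y').
Proof. by move=> xx' yy'; rewrite mulrA xx' [17%:R * x']mulrC -mulrA yy' mulrCA. Qed.

Lemma addr17_mod (x x' y y' : pser K) :
  17%:R * x = 17%:R * x' -> 17%:R * y = 17%:R * y' ->
  17%:R * (x + y) = 17%:R * (x' + y').
Proof. by move=> xx' yy'; rewrite !mulrDr xx' yy'. Qed.

Lemma oppr17_mod (x x' : pser K) :
  17%:R * x = 17%:R * x' -> 17%:R * - x = 17%:R * - x'.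
Proof. by rewrite !mulrN => ->. Qed.

Lemma expr17_mod (x x' : pser K) n :
  17%:R * x = 17%:R * x' -> 17%:R * x ^+ n = 17%:R * x' ^+ n.
Proof.
by move=> xx'; elim: n => // n IHn; rewrite !exprS; apply: mulr17_mod.
Qed.

Ltac mod17 := repeat first [ match goal with |- ?x = ?x => reflexivity end
  | eassumption | apply: mulr17_mod | apply: addr17_mod | apply: oppr17_mod
  | apply: expr17_mod ].

Lemma sigma_at0 j : sigma j 0 = 0.
Proof. by rewrite /sigma /divisor_sum big_mkcond big_ord_recl big_ord0. Qed.

Lemma sigma_at1 j : sigma j 1 = 1.
Proof.
rewrite /sigma /divisor_sum big_mkcond big_ord_recl big_ord_recl big_ord0 /=.
by rewrite expr1n addr0 add0r.
Qed.

Lemma coef_eQ n : coef eQ n = (n == 0%N)%:R + 240%:R * (sigma 3 n)%:~R.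
Proof.
rewrite -[coef eQ n]/((coef eisQ n)%:~R) pser_coefD pser_coef1 coef_natl.
by rewrite rmorphD rmorphM !rmorph_nat.
Qed.

Lemma coef_eR n : coef eR n = (n == 0%N)%:R - 504%:R * (sigma 5 n)%:~R.
Proof.
rewrite -[coef eR n]/((coef eisR n)%:~R) pser_coefB pser_coef1 coef_natl.
by rewrite rmorphB rmorphM !rmorph_nat.
Qed.

Lemma ev_A : ev pA = eQ * (8%:R * eQ ^+ 3 + 10%:R * eR ^+ 2).
Proof. by rewrite /pA !ev_simpl. Qed.

Lemma ev_B : ev pB = eR * (7%:R * eQ ^+ 3 + 11%:R * eR ^+ 2).
Proof. by rewrite /pB !ev_simpl. Qed.

Lemma ev_Delta : ev pDelta = 48%:R * (eQ ^+ 3 - eR ^+ 2).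
Proof. by rewrite /pDelta !ev_simpl. Qed.

Lemma ev_T : ev pT = ev pT0 + eP * ev pT1 + eP ^+ 2 * ev pT2.
Proof. by rewrite /pT evD evD evM evM evX ev_P. Qed.

Lemma ev_N : ev pN = ev pN0 + eP * ev pN1 + eP ^+ 2 * ev pN2.
Proof. by rewrite /pN evD evD evM evM evX ev_P. Qed.

Lemma ev_T' : ev pT' =
  ev pA * (ev pA ^+ 2 * ev pT0 + ev pA * (ev pB * ev pT1) + ev pB ^+ 2 * ev pT2).
Proof. by rewrite /pT' evM evD evD !(evM (_ ^ _)%P3) !evX evM evM. Qed.

Lemma ev_N' : ev pN' =
  ev pA ^+ 2 * ev pN0 + ev pA * (ev pB * ev pN1) + ev pB ^+ 2 * ev pN2.
Proof. by rewrite /pN' evD evD !(evM (_ ^ _)%P3) !evX evM evM. Qed.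

Lemma ev_F' : ev pF' = ev pDelta ^+ 6 * (ev pT' - ev pf * ev pN').
Proof. by rewrite /pF' evM evX evD evN evM. Qed.

Lemma ev_AB17 : 17%:R * ev pA = 17%:R /\ 17%:R * ev pB = 17%:R * eP.
Proof.
have evL : ev (poly3_add (iter 16 pD pP) (poly3_exp pP 17)) =
    iter 16 (@theta K) eP + eP ^+ 17.
  by rewrite evD evX -(iter_theta_ev 16 pP) ev_P.
have evDA p : ev (poly3_mul (poly3_const 12) (pD p)) = 12%:R * theta (ev p).
  by rewrite evM evC -theta_ev.
(* A and B have constant term 18, so the constant term to invert is (18 + 1)(18^2 + 1) = 6175, and
   30 * 6175 = 1 + 289 * 641. *)
apply: (@eisenstein_mod17 _ eQ _ _ 30%:R).
- by rewrite -evM -(ev_eq17 theta16_P) evL theta16_eP.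
- by rewrite -evDA (ev_eq17 deriv_A) evD evN evM ev_P.
- by rewrite -evDA (ev_eq17 deriv_B) evD evN evM evM ev_P ev_Q.
- have := congr1 (map_pser K) theta_eisP.
  by rewrite rmorphM rmorph_nat rmorphB rmorphXn /= map_pser_theta.
rewrite pser_coefM0 !pser_coefD pser_coefX0 pser_coef1 ev_A ev_B.
rewrite !pser_coefM0 !pser_coefD !coef_natl !pser_coefX0.
rewrite coef_eQ coef_eR !sigma_at0 eqxx (_ : true%:R = 1 :> K) // !mulr0 addr0 subr0 !expr1n.
transitivity (1 + 289%:R * 641%:R : K); first by ring.
by rewrite char289 mul0r addr0.
Qed.

Let A17 : 17%:R * ev pA = 17%:R * 1.
Proof. by rewrite mulr1; case: ev_AB17. Qed.

Let B17 : 17%:R * ev pB = 17%:R * eP.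
Proof. by case: ev_AB17. Qed.

Lemma iter_theta_ev17 n p :
  17%:R * iter n (@theta K) (ev p) = 17%:R * ev (iter n pD' p).
Proof.
have tP : 17%:R * theta eP = 17%:R * ev (265%:P3 * (pB ^ 2 - pQ))%P3.
  rewrite theta_eP /pdeltaP 2!ev_scaled_sub 2!evX ev_P.
  by mod17; rewrite B17.
have tQ : 17%:R * theta eQ = 17%:R * ev (193%:P3 * (pB * pQ - pA * pR))%P3.
  (* R is written as 1 * R so that the 1 can be exchanged for A. *)
  rewrite theta_eQ /pdeltaQ 2!ev_scaled_sub 3!evM ev_P -[ev pR]mul1r.
  by mod17; rewrite ?A17 ?B17 ?mul1r.
have tR : 17%:R * theta eR = 17%:R * ev (145%:P3 * (pB * pR - pA * pQ ^ 2))%P3.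
  rewrite theta_eR /pdeltaR 2!ev_scaled_sub 3!evM ev_P -[ev (pQ ^ 2)%P3]mul1r.
  by mod17; rewrite ?A17 ?B17 ?mul1r.
exact: (@poly3_eval_iter_deriv _ eP eQ eR pser_char289 (@theta K) 17 _ _ _ (@thetaM K)
  tP tQ tR).
Qed.

Lemma coef_Delta6 : (forall n, coef (ev pDelta ^+ 6) (17 * n) = 17%:R * coef (ev pu) n) /\
  (forall n, coef (ev pDelta ^+ 6) (289 * n) = 0).
Proof.
have drop_A k x : 17%:R * (ev pA ^+ k * x) = 17%:R * x.
  by have := mulr17_mod (expr17_mod k A17) (erefl (17%:R * x)); rewrite expr1n mul1r.
have evX6 p : ev (poly3_mul (poly3_exp pDelta 6) p) = ev pDelta ^+ 6 * ev p.
  by rewrite evM evX.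
apply: (@U_Delta6 (ev pA) _ (ev pDelta ^+ 6 * ev pf) (ev pT) (ev pN) (ev pF')).
- by rewrite A17 mulr1.
- by rewrite !theta_ev (ev_eq289 deriv2_A) evM evC.
- rewrite -!evX6 !theta_ev -(ev_eq289 deriv2_f) evD; congr (_ + _).
  by rewrite [RHS]evM [ev (poly3_mul (poly3_const _) _)]evM evC evM mulrA.
- rewrite ev_F' ev_T' ev_N' ev_T ev_N.
  (* The factors 1 stand exactly where [pT'] and [pN'] have A, and P where they have B. *)
  transitivity (17%:R * (ev pDelta ^+ 6 *
    (1 * (1 ^+ 2 * ev pT0 + 1 * (eP * ev pT1) + eP ^+ 2 * ev pT2)
     - ev pf * (1 ^+ 2 * ev pN0 + 1 * (eP * ev pN1) + eP ^+ 2 * ev pN2)))); first by ring.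
  by symmetry; mod17.
- have evL : ev (iter 16 pD' pF' + pA * pu ^ 17)%P3 =
      ev (iter 16 pD' pF') + ev pA * ev pu ^+ 17.
    by apply: etrans (evD _ _) _; congr (_ + _);
      apply: etrans (evM _ _) _; congr (_ * _); exact: evX.
  have evR : ev (pA ^ 18 * pF')%P3 = ev pA ^+ 18 * ev pF' by rewrite evM evX.
  rewrite mulrDr iter_theta_ev17 -(drop_A 1%N (ev pu ^+ 17)) expr1 -mulrDr.
  by rewrite -evL (ev_eq17 U_F) evR drop_A.
- rewrite iter_theta_ev17 (ev_eq17 U_u) evM evX; exact: drop_A.
Qed.

End ModSeries.

(** * Transfer of the vanishing from Delta^6 to series with the same logarithmic derivative *)

Section Vanishing.
Variable K : comNzRingType.
Hypothesis char289 : 289%:R = 0 :> K.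
Hypothesis ann17 : forall c : K, 17%:R * c = 0 -> exists d, c = 17%:R * d.
Hypothesis natK : forall c : K, exists n, c = n%:R.

(** The condition at multiples of 17 makes the one at multiples of 289 stable under products with w
    when theta w = 0: such w may have nonzero coefficients, divisible by 17, at indices divisible by
    17 but not by 289. *)
Definition vanishing (f : pser K) : Prop :=
  (forall n, (17 %| n)%N -> exists d, coef f n = 17%:R * d) /\
  (forall n, (289 %| n)%N -> coef f n = 0).

Lemma natr_unit_mul0 n (c : K) : ~~ (17 %| n)%N -> n%:R * c = 0 -> c = 0.
Proof.
move=> n17 nc; have [i ni] := natr289_inv char289 n17.
have -> : c = n%:R * i%:R * c by rewrite ni mul1r.
by rewrite mulrAC nc mul0r.
Qed.

Lemma theta0_coef0 (w : pser K) n : theta w = 0 -> ~~ (17 %| n)%N -> coef w n = 0.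
Proof.
by move=> w0 n17; apply: (natr_unit_mul0 n17); rewrite -coef_theta w0 pser_coef0.
Qed.

Lemma theta0_coef17 (w : pser K) n : theta w = 0 -> ~~ (289 %| n)%N ->
  exists d, coef w n = 17%:R * d.
Proof.
move=> w0 n289; apply: ann17.
case: (boolP (17 %| n)%N) => [/dvdnP[m nE]|n17]; last by rewrite theta0_coef0 ?mulr0.
have m17 : ~~ (17 %| m)%N.
  apply: contra n289 => m17; rewrite nE -[289%N]/(17 * 17)%N.
  by rewrite dvdn_pmul2r.
apply: (natr_unit_mul0 m17); rewrite mulrA -natrM -nE.
by rewrite -coef_theta w0 pser_coef0.
Qed.

Lemma mul17_17 (c d : K) : 17%:R * c * (17%:R * d) = 0.
Proof. by transitivity (289%:R * (c * d)); [ring | rewrite char289 mul0r]. Qed.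

(** For 289 | n: if 17 does not divide n - i, then w_(n - i) = 0; if 17 but not 289 divides it, both
    factors are multiples of 17; if 289 divides it, then 289 | i and f_i = 0. *)
Lemma vanishing_term (f w : pser K) n i : theta w = 0 -> (i <= n)%N ->
  ((17 %| i)%N -> exists d, coef f i = 17%:R * d) ->
  ((289 %| i)%N -> coef f i = 0) ->
  ((17 %| n)%N -> exists d, coef f i * coef w (n - i) = 17%:R * d) /\
  ((289 %| n)%N -> coef f i * coef w (n - i) = 0).
Proof.
move=> w0 le_in f17 f289; case: (boolP (17 %| n - i)%N) => [ni17|ni17]; last first.
  by rewrite (theta0_coef0 w0 ni17) mulr0; split=> // _; exists 0; rewrite mulr0.
have i17 : (17 %| n)%N -> (17 %| i)%N.
  by move=> n17; rewrite -(subKn le_in) dvdn_sub.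
split=> [/i17/f17[d ->]|n289]; first by exists (d * coef w (n - i)); rewrite mulrA.
have [d fi] := f17 (i17 (dvdn_trans (isT : 17 %| 289)%N n289)).
case: (boolP (289 %| n - i)%N) => [ni289|ni289].
  by rewrite f289 ?mul0r // -(subKn le_in) dvdn_sub.
by have [e ->] := theta0_coef17 w0 ni289; rewrite fi mul17_17.
Qed.

Lemma sum_mult17 (I : finType) (F : I -> K) (c : K) :
  (forall i, exists d, F i = c * d) -> exists d, \sum_i F i = c * d.
Proof.
move=> Fc; apply: (big_ind (fun x => exists d, x = c * d)) => //.
- by exists 0; rewrite mulr0.
- by move=> x y [d ->] [e ->]; exists (d + e); rewrite mulrDr.
Qed.

Lemma vanishingM (f w : pser K) : theta w = 0 -> vanishing f -> vanishing (f * w).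
Proof.
move=> w0 [f17 f289].
have term n (i : 'I_n.+1) := vanishing_term w0 (ltn_ord i : i <= n)%N (f17 i) (f289 i).
split=> n nd; rewrite pser_coefM.
  by apply: sum_mult17 => i; apply: (term n i).1.
by apply: big1 => i _; apply: (term n i).2.
Qed.

(** The constant term of w is a unit, so f_n is determined by (f w)_n and the earlier f_i, to which
    [vanishing_term] applies by induction. *)
Lemma vanishingM_inv (f w : pser K) c : theta w = 0 -> coef w 0 * c = 1 ->
  vanishing (f * w) -> vanishing f.
Proof.
move=> w0 wc [fw17 fw289].
suff H n : ((17 %| n)%N -> exists d, coef f n = 17%:R * d) /\
    ((289 %| n)%N -> coef f n = 0) by split=> n; case: (H n).
elim/ltn_ind: n => n IHn.
have fE : coef f n = c * coef (f * w) n
    - c * \sum_(i < n) coef f i * coef w (n - i).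
  by rewrite pser_coefM big_ord_recr /= subnn mulrDr addrAC subrr add0r mulrCA
    [c * _]mulrC wc mulr1.
have term (i : 'I_n) :=
  vanishing_term w0 (ltnW (ltn_ord i)) (IHn i (ltn_ord i)).1 (IHn i (ltn_ord i)).2.
split=> nd; rewrite fE.
  have [d ->] := fw17 n nd.
  have [e ->] : exists e, \sum_(i < n) coef f i * coef w (n - i) = 17%:R * e.
    by apply: sum_mult17 => i; apply: (term i).1.
  by exists (c * d - c * e); ring.
rewrite (fw289 n nd) big1 ?mulr0 ?subrr // => i _; exact: (term i).2.
Qed.

Notation P := (eP K).
Notation ev := (poly3_eval (eP K) (eQ K) (eR K)).

Lemma vanishing_Delta6 : vanishing (ev pDelta ^+ 6).
Proof.
have [D17 D289] := coef_Delta6 char289 ann17 natK; split=> n /dvdnP[m ->].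
  by rewrite mulnC D17; exists (coef (ev pu) m).
by rewrite mulnC D289.
Qed.

(** Delta / q, a series with constant term 1 and logarithmic derivative P - 1. *)
Definition delta := shift (ev pDelta).

Lemma coef_Delta01 : coef (ev pDelta) 0 = 0 /\ coef (ev pDelta) 1 = 1.
Proof.
have coefM1 (f g : pser K) :
    coef (f * g) 1 = coef f 0 * coef g 1 + coef f 1 * coef g 0.
  by rewrite pser_coefM big_ord_recl big_ord_recl big_ord0 addr0.
have Q0 : coef (eQ K) 0 = 1 by rewrite coef_eQ sigma_at0 mulr0 addr0.
have R0 : coef (eR K) 0 = 1 by rewrite coef_eR sigma_at0 mulr0 subr0.
have Q1 : coef (eQ K) 1 = 240%:R by rewrite coef_eQ sigma_at1 mulr1 add0r.
have R1 : coef (eR K) 1 = - 504%:R by rewrite coef_eR sigma_at1 mulr1 sub0r.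
rewrite ev_Delta // !coef_natl !pser_coefB !exprS !expr0 !mulr1.
rewrite !(coefM1, pser_coefM0) Q0 Q1 R0 R1; split; first by ring.
(* The coefficient is 48 (3 * 240 + 2 * 504) = 48 * 1728. *)
transitivity (1 + 289%:R * 287%:R : K); first by ring.
by rewrite char289 mul0r addr0.
Qed.

Lemma DeltaE : ev pDelta = qX K * delta.
Proof.
by rewrite [LHS]shiftK coef_Delta01.1 [X in X + _](_ : _ = 0) ?add0r.
Qed.

Lemma theta_delta : theta delta = (P - 1) * delta.
Proof.
have : theta (ev pDelta) = P * ev pDelta.
  by rewrite theta_ev // (ev_eq289 char289 pDelta_deriv) evM // ev_P.
rewrite DeltaE thetaM theta_qX => E; apply: qXM_inj.
have -> : qX K * theta delta = qX K * delta + qX K * theta delta - qX K * delta.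
  by ring.
by rewrite E; ring.
Qed.

Lemma theta_exp_delta k : theta (delta ^+ k) = k%:R * (P - 1) * delta ^+ k.
Proof.
rewrite thetaX theta_delta; case: k => [|k]; first by rewrite !mul0r.
by rewrite exprS /=; ring.
Qed.

Lemma solution_vanishes (f : pser K) n :
  theta f = 6%:R * (P - 1) * f -> coef f (289 * n + 283) = 0.
Proof.
move=> tf.
have char289' := pser_char289 char289.
pose d0 := delta ^+ 6.
(* The quotient f / d0 is replaced by f * d0 ^+ 288, since theta (d0 ^+ 289) = 0. *)
have d0E : ev pDelta ^+ 6 = qX K ^+ 6 * d0 by rewrite DeltaE exprMn.
have td k : theta (d0 ^+ k) = (6 * k)%:R * (P - 1) * d0 ^+ k.
  by rewrite /d0 -exprM theta_exp_delta.
have tX : theta (d0 ^+ 289) = 0 by rewrite td natrM char289' mulr0 !mul0r.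
have tw : theta (f * d0 ^+ 288) = 0.
  rewrite thetaM tf td natrM.
  have -> : 6%:R * (P - 1) * f * d0 ^+ 288 + f * (6%:R * 288%:R * (P - 1) * d0 ^+ 288)
     = 289%:R * (6%:R * (P - 1) * f * d0 ^+ 288) by ring.
  by rewrite char289' mul0r.
have X0 : coef (d0 ^+ 289) 0 * 1 = 1.
  by rewrite mulr1 !pser_coefX0 /= coef_Delta01.2 !expr1n.
have : vanishing (qX K ^+ 6 * f).
  (* q^6 f d0^289 = Delta^6 (f d0^288), where theta kills f d0^288; the factor d0^289 is then
     cancelled. *)
  apply: (vanishingM_inv tX X0).
  rewrite exprS mulrA [_ * f * d0]mulrAC -d0E -mulrA.
  exact: vanishingM tw vanishing_Delta6.
(* Index 289 (n + 1) of q^6 f is index 289 n + 283 of f. *)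
case=> _ /(_ (289 * n.+1)%N (dvdn_mulr _ (dvdnn _))).
rewrite coef_qXnM mulnS; case: ltnP => [|_]; first by lia.
by rewrite (_ : 289 + 289 * n - 6 = 289 * n + 283)%N //; lia.
Qed.

End Vanishing.

(** * The coefficients of the Euler product *)

Lemma gbinom_rec (k : rat) i :
  gbinom k i.+1 * i.+1%:R = gbinom k i * (k - i%:R).
Proof.
rewrite /gbinom big_ord_recr /= factS natrM.
have i0 : i.+1%:R != 0 :> rat by rewrite Num.Theory.pnatr_eq0.
have f0 : (i`!)%:R != 0 :> rat by rewrite Num.Theory.pnatr_eq0 -lt0n fact_gt0.
by field; rewrite f0 addrC natr1.
Qed.

Notation half := (- 1 / 2 : rat).
Notation coef_half i := (gbinom half i * (-1) ^+ i).

Lemma coef_half_rec i :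
  2%:R * i.+1%:R * coef_half i.+1 = (2 * i).+1%:R * coef_half i.
Proof.
rewrite exprS; have := gbinom_rec half i.
set g := gbinom half i.+1; set h := gbinom half i; set s := (-1) ^+ i => E.
transitivity (- 2%:R * s * (g * i.+1%:R)); first by ring.
by rewrite E -[(2 * i).+1%:R]natr1 natrM; field.
Qed.

(** The expansion of (1 - 4 x)^(-1/2) by central binomial coefficients; both sides satisfy the same
    recurrence. It bounds the denominators by powers of 4. *)
Lemma coef_half_central i : coef_half i * 4%:R ^+ i = 'C(2 * i, i)%:R.
Proof.
elim: i => [|i IHi]; first by rewrite /gbinom big_ord0 fact0 bin0 divr1 !mulr1.
have i0 : 2%:R * i.+1%:R != 0 :> rat by rewrite -natrM Num.Theory.pnatr_eq0.
apply: (mulfI i0); rewrite mulrA coef_half_rec exprS.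
transitivity (4%:R * (2 * i).+1%:R * (coef_half i * 4%:R ^+ i)); first by ring.
rewrite IHi -!natrM; congr _%:R.
have -> : (2 * i.+1 = (2 * i).+2)%N by rewrite mulnS.
have := mul_bin_diag (2 * i).+2 i; have := mul_bin_down (2 * i).+1 i.
have -> : ((2 * i).+1 - i = i.+1)%N by lia.
by rewrite /=; lia.
Qed.

(** Integrality of f(4 q). *)
Definition scaled_integral (f : fps) : Prop :=
  forall n, exists z : int, f n * 4%:R ^+ n = z%:~R.

Lemma scaled_integral_mul f g :
  scaled_integral f -> scaled_integral g -> scaled_integral (fps_mul f g).
Proof.
move=> fz gz n; rewrite /fps_mul mulr_suml.
apply: (big_ind (fun x : rat => exists z : int, x = z%:~R)).
- by exists 0.
- by move=> x y [u ->] [v ->]; exists (u + v); rewrite rmorphD.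
move=> i _; have [u fu] := fz i; have [v gv] := gz (n - i)%N.
exists (u * v); rewrite rmorphM /= -fu -gv.
have -> : 4%:R ^+ n = 4%:R ^+ i * 4%:R ^+ (n - i) :> rat.
  by rewrite -exprD subnKC // -ltnS.
ring.
Qed.

Lemma scaled_integral_factor m : (0 < m)%N -> scaled_integral (factor_pow half m).
Proof.
move=> m0 n; rewrite /factor_pow; case: ifP => [/dvdnP[i ->]|_]; last first.
  by exists 0; rewrite mul0r.
rewrite mulnK //; exists ('C(2 * i, i)%:Z * 4%:R ^+ (i * m.-1)).
rewrite rmorphM rmorphXn /= -[(_%:Z)%:~R]/('C(2 * i, i)%:R) -coef_half_central.
have -> : (i * m = i + i * m.-1)%N by rewrite -mulnS prednK.
by rewrite exprD mulrA.
Qed.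

Lemma scaled_integral_p : scaled_integral (p_ half).
Proof.
suff E N : scaled_integral (euler_partial half N) by move=> n; apply: E.
elim: N => [|N IHN]; last exact: scaled_integral_mul IHN (scaled_integral_factor _).
move=> n; exists ((n == 0%N)%:R); rewrite /euler_partial /fps_one.
by case: n => [|n]; rewrite ?mul1r ?mul0r.
Qed.

(** The Lambert term m q^m / (1 - q^m). *)
Definition multiples (m : nat) : pser rat :=
  PSer (fun n => if (0 < n)%N && (m %| n)%N then m%:R else 0).

Lemma PSer_mul f g : PSer (fps_mul f g) = PSer f * PSer g :> pser rat.
Proof. by apply: pserP => n; rewrite pser_coefM. Qed.

(* Logarithmic derivative of (1 - q^m)^(-1/2), cleared of the denominator 1 - q^m. *)
Lemma theta_factor m : (0 < m)%N ->
  2%:R * theta (PSer (factor_pow half m)) = multiples m * PSer (factor_pow half m).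
Proof.
move=> m0; set F := PSer _.
have unit0 : coef (1 - qX rat ^+ m) 0 * 1 = 1.
  rewrite mulr1 pser_coefB pser_coef1 -[qX rat ^+ m]mulr1 coef_qXnM m0.
  by rewrite subr0.
have lin f n : coef ((1 - qX rat ^+ m) * f) n =
    coef f n - (if (n < m)%N then 0 else coef f (n - m)).
  by rewrite mulrBl mul1r pser_coefB coef_qXnM.
have mult : (1 - qX rat ^+ m) * multiples m = m%:R * qX rat ^+ m.
  apply: pserP => n; rewrite lin coef_natl -[qX rat ^+ m]mulr1 coef_qXnM pser_coef1 /=.
  case: (ltnP n m) => [nm|mn].
    by rewrite subr0 mulr0; case: (posnP n) => //= n0; rewrite gtnNdvd.
  rewrite (leq_trans m0 mn) subn_gt0 subn_eq0 (dvdn_subl mn (dvdnn m)) /=.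
  by case: ltngtP mn => //= [mn|<-] _; rewrite ?dvdnn ?subrr ?mulr0 ?subr0 ?mulr1.
apply/subr0_eq; apply: (unit_coef0_reg unit0); rewrite mulrBr [X in _ - X]mulrA mult.
apply/eqP; rewrite subr_eq0; apply/eqP; apply: pserP => n.
rewrite lin -mulrA !coef_natl coef_qXnM !coef_theta /= /factor_pow.
case: (ltnP n m) => [nm|mn].
  rewrite subr0 mulr0; case: (posnP n) => [->|n0]; first by rewrite mul0r mulr0.
  by rewrite gtnNdvd // !mulr0.
rewrite (dvdn_subl mn (dvdnn m)); case: ifP => [/dvdnP[[|i] nE]|_]; last by rewrite !mulr0 subrr.
  by move: mn; rewrite nE; lia.
have -> : (n - m = i * m)%N by rewrite nE mulSn addKn.
rewrite nE !mulnK // !natrM.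
have := coef_half_rec i; move: (coef_half i.+1) (coef_half i) => c' c E.
transitivity (m%:R * (2%:R * i.+1%:R * c') - 2%:R * i%:R * m%:R * c); first by ring.
by rewrite E -[(2 * i).+1%:R]natr1 natrM; ring.
Qed.

Lemma theta_euler_partial N : 2%:R * theta (PSer (euler_partial half N)) =
  (\sum_(m < N) multiples m.+1) * PSer (euler_partial half N).
Proof.
elim: N => [|N IHN].
  rewrite big_ord0 mul0r.
  have -> : PSer (euler_partial half 0) = 1 by apply: pserP => n; rewrite pser_coef1.
  by rewrite theta1 mulr0.
rewrite big_ord_recr /= PSer_mul thetaM.
transitivity (2%:R * theta (PSer (euler_partial half N)) * PSer (factor_pow half N.+1)
  + PSer (euler_partial half N) * (2%:R * theta (PSer (factor_pow half N.+1)))).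
  by ring.
by rewrite IHN theta_factor //; ring.
Qed.

Lemma sum_multiples N n : (n <= N)%N ->
  coef (\sum_(m < N) multiples m.+1) n = (sigma 1 n)%:~R.
Proof.
move=> nN; have coef_sum I (r : seq I) (F : I -> pser rat) :
    coef (\sum_(i <- r) F i) n = \sum_(i <- r) coef (F i) n.
  by elim: r => [|i r IHr]; rewrite ?big_nil ?pser_coef0 // !big_cons pser_coefD IHr.
have sE : sigma 1 n = \sum_(m < n) (if (m.+1 %| n)%N then m.+1%:R else 0).
  rewrite /sigma /divisor_sum big_mkcond big_ord_recl /= add0r.
  by apply: eq_bigr => m _; rewrite /= expr1.
rewrite coef_sum sE rmorph_sum.
rewrite (big_ord_widen N (fun m => (if (m.+1 %| n)%N then m.+1%:R else 0 : int)%:~R : rat)) //.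
rewrite [RHS]big_mkcond; apply: eq_bigr => m _ /=.
case: (posnP n) => [->|n0] //=; case: ifP => mn; last by case: ifP.
by rewrite (dvdn_leq n0 mn) rmorph_nat.
Qed.

(** Coefficient n of the identity for the n-th partial product, which agrees with the infinite
    product up to q^n. *)
Lemma p_half_rec n : 2%:R * n%:R * p_ half n =
  \sum_(j < n.+1) (sigma 1 j)%:~R * p_ half (n - j).
Proof.
have := congr1 (fun f => coef f n) (theta_euler_partial n).
rewrite coef_natl coef_theta mulrA => ->; rewrite pser_coefM.
apply: eq_bigr => j _; rewrite sum_multiples -1?ltnS //.
by rewrite /= euler_partial_stable // leq_subr.
Qed.

Definition half_num (n : nat) : int := numq (p_ half n * 4%:R ^+ n).

Lemma half_numE n : p_ half n * 4%:R ^+ n = (half_num n)%:~R.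
Proof. by rewrite /half_num; have [z ->] := scaled_integral_p n; rewrite numq_int. Qed.

Lemma half_num_rec n : 2%:R * n%:R * half_num n =
  \sum_(j < n.+1) sigma 1 j * 4%:R ^+ j * half_num (n - j).
Proof.
apply: (@intr_inj rat); rewrite rmorph_sum !rmorphM !rmorph_nat /= -half_numE.
rewrite mulrA p_half_rec mulr_suml; apply: eq_bigr => j _.
rewrite !rmorphM rmorphXn rmorph_nat /= -half_numE.
have -> : 4%:R ^+ n = 4%:R ^+ j * 4%:R ^+ (n - j) :> rat.
  by rewrite -exprD subnKC // -ltnS.
ring.
Qed.

(** As u inverts 4, the series f is the reduction to K of the rational series with coefficients
    [p_ half n]. *)
Lemma theta_half_series (K : comNzRingType) (u : K) : u * 4%:R = 1 ->
  let f := PSer (fun n => (half_num n)%:~R * u ^+ n) in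
  2%:R * theta f = map_pser K (sigma_series 1) * f.
Proof.
move=> u4 f; apply: pserP => m; rewrite coef_natl coef_theta pser_coefM /=.
have := congr1 (intr : int -> K) (half_num_rec m).
rewrite !rmorphM !rmorph_nat rmorph_sum /= => E.
rewrite mulrA mulrA E mulr_suml; apply: eq_bigr => j _.
have -> : u ^+ m = u ^+ j * u ^+ (m - j) by rewrite -exprD subnKC // -ltnS.
have uj : u ^+ j * 4%:R ^+ j = 1 by rewrite -exprMn u4 expr1n.
rewrite !rmorphM rmorphXn rmorph_nat /=.
move: (u ^+ j) (u ^+ (m - j)) (4%:R ^+ j) uj => uj umj u4j E1.
set s := (sigma _ _)%:~R; set z := (half_num _)%:~R.
by transitivity (s * (z * umj) * (uj * u4j)); [ring | rewrite E1 mulr1].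
Qed.

Lemma half_num_vanishes (K : comNzRingType) n : 289%:R = 0 :> K ->
  (forall c : K, 17%:R * c = 0 -> exists d, c = 17%:R * d) ->
  (forall c : K, exists n, c = n%:R) ->
  (half_num (289 * n + 283))%:~R = 0 :> K.
Proof.
(* 217 is the inverse of 4 modulo 289: 868 = 1 + 289 * 3. *)
move=> char289 ann17 natK; pose u : K := 217%:R.
have u4 : u * 4%:R = 1.
  transitivity (1 + 289%:R * 3%:R : K); first by rewrite /u; ring.
  by rewrite char289 mul0r addr0.
have := theta_half_series u4; set f := PSer _ => /= tf.
have tf' : theta f = 6%:R * (eP K - 1) * f.
  have -> : eP K = 1 - 24%:R * map_pser K (sigma_series 1).
    by rewrite /eP /eisP rmorphB rmorphM rmorph1 rmorph_nat.
  (* 145 inverts 2, and 145 = 289 - 144 turns it into -144 = 6 * (-24), the factor of 6 (P - 1). *)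
  rewrite (mul_from_inverse char289 (erefl : 2 * 145 = 1 %[mod 289])%N tf).
  move: (map_pser _ _) => S.
  transitivity (289%:R * (S * f) - 144%:R * (S * f)); first by ring.
  by rewrite (pser_char289 char289); ring.
have := solution_vanishes char289 ann17 natK n tf'.
rewrite /= => /(congr1 ( *%R^~ (4%:R ^+ (289 * n + 283)))).
by rewrite -mulrA -exprMn u4 expr1n mulr1 mul0r.
Qed.

(** * The ring Z/289 and the return to reduced fractions *)

Notation Z289 := 'Z_289.

Lemma Z289_natr (n : nat) : n%:R = 0 :> Z289 -> (289 %| n)%N.
Proof. by move=> /(congr1 (@nat_of_ord _)); rewrite val_Zp_nat // => /eqP. Qed.

Lemma Z289_char : 289%:R = 0 :> Z289.
Proof. by rewrite -Zp_nat_mod // modnn. Qed.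

Lemma Z289_nat (c : Z289) : exists n, c = n%:R.
Proof. by exists (nat_of_ord c); rewrite natr_Zp. Qed.

Lemma Z289_ann17 (c : Z289) : 17%:R * c = 0 -> exists d, c = 17%:R * d.
Proof.
have [n ->] := Z289_nat c; rewrite -natrM => /Z289_natr.
rewrite -[289%N]/(17 * 17)%N dvdn_pmul2l // => /dvdnP[m ->].
by exists m%:R; rewrite mulnC natrM.
Qed.

Lemma Z289_intr (z : int) : z%:~R = 0 :> Z289 -> (289 %| `|z|)%N.
Proof.
move=> z0; apply: Z289_natr; case: z z0 => n //= /eqP.
by rewrite NegzE mulrNz oppr_eq0 => /eqP.
Qed.

Theorem mainTheorem4 (n : nat) :
  rat_cong0 (p_ (- 1 / 2) (289 * n + 283)%N) 289.
Proof.
set N := (289 * n + 283)%N; set x := p_ _ _.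
(* The equation x 4^N = [half_num N] cleared of denominators. The denominator of x divides 4^N,
   which is prime to 289, so a factor 289 of [half_num N] passes to the numerator. *)
have E : (`|numq x| * 4 ^ N = `|half_num N| * `|denq x|)%N.
  have xE : x * 4%:R ^+ N = (half_num N)%:~R := half_numE N.
  have : (numq x)%:~R * 4%:R ^+ N = (half_num N)%:~R * (denq x)%:~R :> rat.
    by rewrite -xE mulrAC numqE.
  have -> : 4%:R ^+ N = (4%:Z ^+ N)%:~R :> rat by rewrite rmorphXn.
  rewrite -!rmorphM => /intr_inj /(congr1 absz).
  by rewrite !abszM abszX.
have cop4 : coprime (4 ^ N) 289 by rewrite coprimeXl.
have cop : coprime `|denq x| 289.
  have : (`|denq x| %| 4 ^ N)%N.
    rewrite -(Gauss_dvdr _ (_ : coprime `|denq x| `|numq x|)) ?E ?dvdn_mull //.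
    by rewrite coprime_sym coprime_num_den.
  by move=> /coprime_dvdl; apply.
split; first by rewrite coprimezE.
rewrite dvdzE /= -(Gauss_dvdl _ (_ : coprime 289 (4 ^ N))); last by rewrite coprime_sym.
rewrite E dvdn_mulr //; apply: Z289_intr.
exact: half_num_vanishes Z289_char Z289_ann17 Z289_nat.
Qed.
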